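(* Let $\alpha\in[0,1)$ and $\beta,\beta'>0$, and let $A,B$ be invertible m-accretive operators on a complex Hilbert space $\mathbb{H}$ with $\Theta(A)\subseteq S_{\alpha,\beta}$ and $\Theta(B)\subseteq S_{\alpha,\beta'}$. Let $\Phi$ and $\Psi$ be the sesquilinear forms associated with $A$ and $B$, let $\Xi=\Phi+\Psi$ on $D(\Xi)=D(A^{1/2})\cap D(B^{1/2})$, and let $A\dotplus B$ be the operator associated with $\Xi$. Assume that $D(A^{1/2})\cap D(B^{1/2})$ is dense in $\mathbb{H}$ and that $A\dotplus B$ is invertible and m-accretive. Then $$D\big((A\dotplus B)^{1/2}\big)=D\big((A\dotplus B)^{*\,1/2}\big).$$
   Context: $\mathbb{H}$ is a complex Hilbert space with inner product $\langle\cdot,\cdot\rangle$; $D(T)$ is the domain of $T$. The numerical range of an operator $T$ is $\Theta(T)=\{\langle Tu,u\rangle:u\in D(T),\ \|u\|=1\}$. For $\alpha\in[0,1)$ and $\beta>0$, $S_{\alpha,\beta}=\{z\in\mathbb{C}:\operatorname{Re}z\ge0\text{ and }|\operatorname{Im}z|\le\beta(\operatorname{Re}z)^\alpha\}$. $T$ is m-accretive if $\operatorname{Re}\langle Tu,u\rangle\ge0$ for all $u\in D(T)$ and, for all $\lambda$ with $\operatorname{Re}\lambda>0$, $(T+\lambda I)^{-1}$ is a bounded everywhere defined operator with $\|(T+\lambda I)^{-1}\|\le1/\operatorname{Re}\lambda$. $T^{1/2}$ is the usual square root of an m-accretive operator $T$, and $T^{*\,1/2}=(T^* )^{1/2}$.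 For $A,B$ invertible m-accretive with numerical ranges in $S_{\alpha,\beta}$, $S_{\alpha,\beta'}$ one has (McIntosh) $D(A^{1/2})=D(A^{*\,1/2})$ and $D(B^{1/2})=D(B^{*\,1/2})$, and the associated forms are $\Phi(u,v)=\langle A^{1/2}u,A^{*\,1/2}v\rangle$ for $u,v\in D(\Phi)=D(A^{1/2})=D(A^{*\,1/2})$, and $\Psi(u,v)=\langle B^{1/2}u,B^{*\,1/2}v\rangle$ for $u,v\in D(\Psi)=D(B^{1/2})=D(B^{*\,1/2})$. The operator $T$ associated with the densely defined form $\Xi$ is given by: $u\in D(T)$ and $Tu=f$ iff $u\in D(\Xi)$ and $\Xi(u,v)=\langle f,v\rangle$ for all $v\in D(\Xi)$. *)

(* Defs.v *)
From HB Require Import structures.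
From mathcomp Require Import all_boot all_order all_algebra.
From mathcomp Require Import complex.
From mathcomp Require Import all_classical all_reals all_analysis.

Set Implicit Arguments.
Unset Strict Implicit.
Unset Printing Implicit Defensive.

Import Order.TTheory GRing.Theory Num.Theory numFieldNormedType.Exports.

Local Open Scope classical_set_scope.
Local Open Scope ring_scope.
Local Open Scope complex_scope.

(* A complex Hilbert space is a complete normed R[i]-module H with an inner
   product ip : {dot H for Num.conj} (linear on the left, conjugate linear on
   the right) inducing the norm. Norms take their values in R[i].

   An unbounded operator is represented by its graph, a subset of H * H: the
   pair (u, f) belongs to it iff u is in the domain and T u = f. Hence equality
   of operators (equality of sets) includes equality of domains. *)

Definition is_operator (R : realType) (H : completeNormedModType R[i])
    (T : set (H * H)) : Prop :=
  [/\ T (0, 0),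
      forall (a : R[i]) u v f g,
        T (u, f) -> T (v, g) -> T (a *: u + v, a *: f + g)
    & forall u f g, T (u, f) -> T (u, g) -> f = g].

Definition dom (R : realType) (H : completeNormedModType R[i])
    (T : set (H * H)) : set H :=
  [set u | exists f, T (u, f)].

(* The value T u for u in the domain, and 0 outside it. *)
Definition appl (R : realType) (H : completeNormedModType R[i])
    (T : set (H * H)) (u : H) : H :=
  xget 0 [set f | T (u, f)].

Definition op_inv (R : realType) (H : completeNormedModType R[i])
    (T : set (H * H)) : set (H * H) :=
  [set p | T (p.2, p.1)].

(* D(S T) = {u in D(T) | T u in D(S)} *)
Definition op_comp (R : realType) (H : completeNormedModType R[i])
    (S T : set (H * H)) : set (H * H) :=
  [set p | exists2 v, T (p.1, v) & S (v, p.2)].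

Definition op_shift (R : realType) (H : completeNormedModType R[i])
    (T : set (H * H)) (lambda : R[i]) : set (H * H) :=
  [set p | exists2 f, T (p.1, f) & p.2 = f + lambda *: p.1].

Definition bounded_everywhere_by (R : realType)
    (H : completeNormedModType R[i]) (T : set (H * H)) (c : R) : Prop :=
  [/\ is_operator T,
      dom T = setT
    & forall u f, T (u, f) -> `|f| <= c%:C * `|u|].

Definition op_invertible (R : realType) (H : completeNormedModType R[i])
    (T : set (H * H)) : Prop :=
  exists c : R, bounded_everywhere_by (op_inv T) c.

Definition adjoint (R : realType) (H : completeNormedModType R[i])
    (ip : {dot H for (@Num.conj R[i])}) (T : set (H * H)) : set (H * H) :=
  [set p | forall u f, T (u, f) -> ip f p.1 = ip u p.2].

Definition num_range (R : realType) (H : completeNormedModType R[i])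
    (ip : {dot H for (@Num.conj R[i])}) (T : set (H * H)) : set R[i] :=
  [set z | exists u f, [/\ T (u, f), `|u| = 1 & z = ip f u]].

(* For alpha = 0, the convention is 0 `^ 0 = 1. *)
Definition region (R : realType) (alpha beta : R) : set R[i] :=
  [set z | 0 <= complex.Re z /\
           `|complex.Im z| <= beta * (complex.Re z) `^ alpha].

Definition m_accretive (R : realType) (H : completeNormedModType R[i])
    (ip : {dot H for (@Num.conj R[i])}) (T : set (H * H)) : Prop :=
  [/\ is_operator T,
      forall u f, T (u, f) -> 0 <= complex.Re (ip f u)
    & forall lambda : R[i], 0 < complex.Re lambda ->
        bounded_everywhere_by (op_inv (op_shift T lambda))
          (complex.Re lambda)^-1].

(* Kato: an m-accretive operator has exactly one m-accretive square root. The
   default value, the empty graph, is not an operator; it is only reached for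
   operators without such a root. *)
Definition op_sqrt (R : realType) (H : completeNormedModType R[i])
    (ip : {dot H for (@Num.conj R[i])}) (T : set (H * H)) : set (H * H) :=
  xget set0 [set S | m_accretive ip S /\ op_comp S S = T].

Record form (R : realType) (H : completeNormedModType R[i]) := Form {
  form_dom : set H;
  form_val : H -> H -> R[i]  (* meaningful on form_dom only *)
}.

(* The two square roots have the same domain (McIntosh) when T is invertible
   and m-accretive with numerical range in some region alpha beta. *)
Definition form_of (R : realType) (H : completeNormedModType R[i])
    (ip : {dot H for (@Num.conj R[i])}) (T : set (H * H)) : form H :=
  Form (dom (op_sqrt ip T))
    (fun u v =>
       ip (appl (op_sqrt ip T) u) (appl (op_sqrt ip (adjoint ip T)) v)).

Definition form_add (R : realType) (H : completeNormedModType R[i])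
    (Phi Psi : form H) : form H :=
  Form (form_dom Phi `&` form_dom Psi)
    (fun u v => form_val Phi u v + form_val Psi u v).

Definition form_operator (R : realType) (H : completeNormedModType R[i])
    (ip : {dot H for (@Num.conj R[i])}) (Xi : form H) : set (H * H) :=
  [set p | form_dom Xi p.1 /\
           forall v, form_dom Xi v -> form_val Xi p.1 v = ip p.2 v].

(* The form sum of A and B *)
Definition form_sum (R : realType) (H : completeNormedModType R[i])
    (ip : {dot H for (@Num.conj R[i])}) (A B : set (H * H)) : set (H * H) :=
  form_operator ip (form_add (form_of ip A) (form_of ip B)).

(* Main.v *)
Require Import Defs.
From HB Require Import structures.
From mathcomp Require Import all_boot all_order all_algebra.
From mathcomp Require Import complex.
From mathcomp Require Import all_classical all_reals all_analysis.
From mathcomp Require Import zify ring lra.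

Set Implicit Arguments.
Unset Strict Implicit.
Unset Printing Implicit Defensive.

Import Order.TTheory GRing.Theory Num.Theory numFieldNormedType.Exports.

Local Open Scope classical_set_scope.
Local Open Scope ring_scope.
Local Open Scope complex_scope.

(** The numerical range condition is stable under form sums, and it forces
    the square roots of an operator and of its adjoint to have the same
    domain.

    Let T be invertible and m-accretive with numerical range in the region,
    and let L be the bounded inverse of its square root, so that L^2 is the
    inverse of T. The domains of the roots of T and T* are the ranges of L
    and L*, so by duality they agree as soon as |L* x| and |L x| are
    comparable ([range_sub_adjoint]). To compare them, put M = L* - L and K
    = L^2; then L* M + M L = K* - K. This equation is solved by summing over
    the powers of the Cayley transform C = (1 - L) (1 + L)^-1, with A = (1 +
    L)^-1:

      <M f, g> = 2 sum_n <(K* - K) A C^n f, A C^n g>   ([adjdiff_sum]).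

    Since L and L^2 are accretive, elementary energy identities give the
    decay of L A^2 C^n and of L^2 A^4 C^n like 1/n and 1/n^2 ([smoothing],
    [smoothing2]) and a weighted summability of Re <K A^2 C^n f, A^2 C^n f>
    ([smoothing_sum]). With these alone the series diverges logarithmically.
    The region provides the missing factor: |Im <T u, u>| <= beta |Re <T u,
    u>|^alpha |u|^(2 - 2 alpha) implies, for every n, the bound beta
    (n+1)^(-2 (1 - alpha)) (Re <T u, u> + (n+1)^2 |u|^2), and alpha < 1
    makes the series converge. It still contains Re <K y, y> for y on the
    orbit of g, which is at most |L y| (|L y| + |M y|); so |M| enters its
    own estimate, but only to the first power in a bound for its square, and
    it can be absorbed ([adjdiff_bounded]).

    The condition passes from T to T* through the bounded operators (K +
    e)^-1 ([imag_bound_adjoint]), so the comparison holds in both directions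
    ([dom_sqrt_adjoint]). For A and B it shows that the forms are defined on
    the domains of the roots, and an approximation, again by (K + e)^-1,
    extends the numerical range condition to these forms
    ([form_range_bound]). Adding the two conditions gives the condition for
    the form sum, to which the comparison applies. Square roots enter
    through uniqueness only ([accretive_sqrt_unique]): for A and B they
    exist because the intersection of their domains is dense, and the form
    sum has one if and only if its adjoint has one. *)

(** * The real part of a complex inner product *)

Lemma complex_ReD (R : realType) (x y : R[i]) :
  complex.Re (x + y) = complex.Re x + complex.Re y.
Proof. by case: x => a b; case: y. Qed.

Lemma complex_ImD (R : realType) (x y : R[i]) :
  complex.Im (x + y) = complex.Im x + complex.Im y.
Proof. by case: x => a b; case: y. Qed.

Lemma complex_ReN (R : realType) (x : R[i]) : complex.Re (- x) = - complex.Re x.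
Proof. by case: x. Qed.

Section LinearMaps.
Variables (R : realType) (H : completeNormedModType R[i]).
Implicit Types L : {linear H -> H}.

Lemma lopD L x y : L (x + y) = L x + L y.
Proof. exact: raddfD. Qed.

Lemma lopN L x : L (- x) = - L x.
Proof. exact: raddfN. Qed.

Lemma lopZ L a x : L (a *: x) = a *: L x.
Proof. exact: linearZ. Qed.

Lemma lop0 L : L 0 = 0.
Proof. exact: raddf0. Qed.

(** The map is an explicit argument: a pattern open in it would also match the
    opposite, which is a linear map. *)
Definition lopE L := (lopD L, lopN L, lopZ L, lop0 L).

End LinearMaps.

Section RealPart.
Variables (R : realType) (H : completeNormedModType R[i]).
Variable ip : {dot H for (@Num.conj R[i])}.

(** All estimates use the underlying real Hilbert space: its inner product
    [rip], its squared norm [sqn] and the complex structure [jmul] determine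
    the complex inner product. *)
Definition rip (u v : H) : R := complex.Re (ip u v).

Definition sqn (u : H) : R := rip u u.

Definition jmul (u : H) : H := 'i%C *: u.

Lemma ip_conj u v : ip u v = (ip v u)^*.
Proof. by rewrite hermC /= expr0 mul1r. Qed.

Lemma ripC u v : rip u v = rip v u.
Proof. by rewrite /rip (ip_conj u v); case: (ip v u) => x y; reflexivity. Qed.

Lemma ripDl u v w : rip (u + v) w = rip u w + rip v w.
Proof. by rewrite /rip linearDl complex_ReD. Qed.

Lemma ripNl u w : rip (- u) w = - rip u w.
Proof. by rewrite /rip linearNl complex_ReN. Qed.

Lemma ripZl (a : R) u w : rip (a%:C *: u) w = a * rip u w.
Proof.
rewrite /rip linearZl_LR /=; case: (ip u w) => x y /=.
by rewrite mul0r subr0.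
Qed.

Lemma ripDr u v w : rip w (u + v) = rip w u + rip w v.
Proof. by rewrite !(ripC w) ripDl. Qed.

Lemma ripNr u w : rip w (- u) = - rip w u.
Proof. by rewrite !(ripC w) ripNl. Qed.

Lemma ripZr (a : R) u w : rip w (a%:C *: u) = a * rip w u.
Proof. by rewrite !(ripC w) ripZl. Qed.

Lemma rip_jl u v : rip (jmul u) v = - complex.Im (ip u v).
Proof.
by rewrite /rip /jmul linearZl_LR /=; case: (ip u v) => x y /=; ring.
Qed.

Lemma rip_jr u v : rip u (jmul v) = complex.Im (ip u v).
Proof. by rewrite ripC rip_jl (ip_conj u v); case: (ip v u). Qed.

Lemma rip_jj u v : rip (jmul u) (jmul v) = rip u v.
Proof.
rewrite rip_jr /rip /jmul linearZl_LR /=; case: (ip u v) => x y /=; ring.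
Qed.

Lemma rip_jN u v : rip (jmul u) v = - rip u (jmul v).
Proof. by rewrite rip_jl rip_jr. Qed.

Lemma rip_jC u v : rip u (jmul v) = - rip v (jmul u).
Proof. by rewrite ripC rip_jN. Qed.

Lemma rip_j0 u : rip u (jmul u) = 0.
Proof. by have := rip_jC u u; lra. Qed.

Lemma ripZc (a : R[i]) u v : rip (a *: u) v = rip u (conjc a *: v).
Proof.
rewrite /rip linearZl_LR linearZr_LR /=.
by case: a => x y; case: (ip u v) => z t /=; rewrite opprK.
Qed.

Lemma rip0l v : rip 0 v = 0.
Proof. by rewrite /rip linear0l. Qed.

Lemma rip0r v : rip v 0 = 0.
Proof. by rewrite ripC rip0l. Qed.

Definition ripE := (ripDl, ripDr, ripNl, ripNr, ripZl, ripZr).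

Lemma ipE u v : ip u v = rip u v +i* rip u (jmul v).
Proof. by rewrite rip_jr /rip; case: (ip u v). Qed.

Hypothesis ip_norm : forall u : H, `|u| ^+ 2 = ip u u.

Lemma sqn_norm u : `|u| ^+ 2 = (sqn u)%:C.
Proof.
have := exprn_ge0 2 (normr_ge0 u); rewrite ip_norm /sqn /rip.
by case: (ip u u) => x y; rewrite lecE /= => /andP[/eqP -> _].
Qed.

Lemma sqn_ge0 u : 0 <= sqn u.
Proof. by rewrite -ler0c -sqn_norm exprn_ge0. Qed.

Lemma sqn_eq0 u : sqn u = 0 -> u = 0.
Proof.
move=> e; apply/eqP; rewrite -normr_eq0.
have : `|u| ^+ 2 == 0 by rewrite sqn_norm e.
by rewrite expf_eq0.
Qed.

Lemma rip_eq u v : (forall x, rip x u = rip x v) -> u = v.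
Proof.
move=> e; apply/eqP; rewrite -subr_eq0; apply/eqP/sqn_eq0.
by rewrite /sqn ripDr ripNr e subrr.
Qed.

Lemma sqnD u v : sqn (u + v) = sqn u + 2 * rip u v + sqn v.
Proof. by rewrite /sqn !ripE (ripC v u); ring. Qed.

Lemma sqnB u v : sqn (u - v) = sqn u - 2 * rip u v + sqn v.
Proof. by rewrite /sqn !ripE (ripC v u); ring. Qed.

Lemma sqnN u : sqn (- u) = sqn u.
Proof. by rewrite /sqn !ripE opprK. Qed.

Lemma sqnZ a u : sqn (a%:C *: u) = a ^+ 2 * sqn u.
Proof. by rewrite /sqn !ripE; ring. Qed.

Lemma sqnZc (a : R[i]) u :
  sqn (a *: u) = (complex.Re a ^+ 2 + complex.Im a ^+ 2) * sqn u.
Proof.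
have -> : a *: u = (complex.Re a)%:C *: u + (complex.Im a)%:C *: jmul u.
  by rewrite /jmul scalerA -scalerDl {1}[a]complexE [_ * 'i%C]mulrC.
have im0 : complex.Im (ip u u) = 0 by rewrite -ip_norm sqn_norm.
by rewrite sqnD !sqnZ !ripE rip_jr im0 /sqn rip_jj; ring.
Qed.

Lemma sqnJ u : sqn (jmul u) = sqn u.
Proof. exact: rip_jj. Qed.

Lemma sqnD_le u v : sqn (u + v) <= 2 * sqn u + 2 * sqn v.
Proof. by have := sqn_ge0 (u - v); rewrite sqnB sqnD; lra. Qed.

Lemma cauchy_schwarz u v : rip u v ^+ 2 <= sqn u * sqn v.
Proof.
have h := sqn_ge0 ((sqn v)%:C *: u - (rip u v)%:C *: v).
rewrite sqnB !sqnZ !ripE in h.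
have := sqn_ge0 v; rewrite le_eqVlt => /predU1P[e|vp].
  by rewrite (sqn_eq0 (esym e)) rip0r expr0n mulr_ge0 // sqn_ge0.
rewrite -(ler_pM2l vp); lra.
Qed.

(** Cauchy-Schwarz with a free weight, so that no square root is needed. *)
Lemma rip_young (t : R) u v : 0 < t ->
  2 * `|rip u v| <= t * sqn u + t^-1 * sqn v.
Proof.
move=> t0; have ti : t * t^-1 = 1 by rewrite divff // gt_eqF.
have h s : s ^+ 2 = 1 -> 0 <= t * sqn u + 2 * s * rip u v + t^-1 * sqn v.
  move=> s1; rewrite -(pmulr_rge0 _ t0).
  suff <- : sqn (t%:C *: u + s%:C *: v)
    = t * (t * sqn u + 2 * s * rip u v + t^-1 * sqn v) by exact: sqn_ge0.
  rewrite sqnD !sqnZ !ripE s1 [RHS]mulrDr [t * (t^-1 * _)]mulrA ti; ring.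
have [_|_] := ger0P (rip u v).
  by have := h (-1); rewrite sqrrN expr1n => /(_ erefl); lra.
by have := h 1; rewrite expr1n => /(_ erefl); lra.
Qed.

Lemma jmulD u v : jmul (u + v) = jmul u + jmul v.
Proof. exact: scalerDr. Qed.

Lemma jmulN u : jmul (- u) = - jmul u.
Proof. exact: scalerN. Qed.

Lemma jmulK u : jmul (jmul u) = - u.
Proof. by rewrite /jmul scalerA -expr2 sqr_i scaleN1r. Qed.

Lemma lop_jmul (L : {linear H -> H}) u : L (jmul u) = jmul (L u).
Proof. exact: lopZ. Qed.

End RealPart.

Section Polarization.
Variables (R : realType) (H : completeNormedModType R[i]).
Variable ip : {dot H for (@Num.conj R[i])}.
Local Notation r := (rip ip).
Local Notation q := (sqn ip).

Variables (K : {linear H -> H}) (b s : R).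
Hypothesis K_im : forall x,
  `|r (K x) (jmul x)| <= b * (r (K x) x + s * q (K x)).

Let G x := r (K x) x + s * q (K x).

(* With y = i z the left hand side becomes a symmetric real form in x and z,
   to which the polarization identity applies. *)
Let polar1 x y : r x (K y) - r (K x) y <= b * (G x + G y).
Proof.
have [z ->] : exists z, y = jmul z.
  by exists (- jmul y); rewrite jmulN jmulK opprK.
have -> : G (jmul z) = G z by rewrite /G !(lop_jmul K) sqnJ rip_jj.
have := K_im (x + z); have := K_im (x - z); rewrite !ler_norml.
move=> /andP[_ h1] /andP[h2 _]; move: h1 h2.
rewrite /G /sqn !(lopD K) !(lopN K) !jmulD !jmulN !(lop_jmul K) !ripE.
rewrite (ripC ip x (jmul _)) rip_jN (ripC ip (K z) (K x)).
lra.
Qed.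

(** The hermitian form i (K* - K) is dominated on the diagonal by a
    nonnegative quadratic form, hence also off the diagonal. Scaling x up
    and y down by the same factor puts in the weight t. *)
Lemma polarization t x y : 0 < t ->
  r x (K y) - r (K x) y
  <= b * (t * (r (K x) x + s * q (K x)) + t^-1 * (r (K y) y + s * q (K y))).
Proof.
move=> t0; pose a := Num.sqrt t.
have a0 : 0 < a by rewrite sqrtr_gt0.
have aE : a * a = t by rewrite -expr2 sqr_sqrtr // ltW.
have a1 : a * a^-1 = 1 by rewrite divff // gt_eqF.
have := polar1 (a%:C *: x) (a^-1%:C *: y).
have GZ c u : G (c%:C *: u) = c * c * G u.
  by rewrite /G !(lopE K) !ripE sqnZ; ring.
rewrite !GZ -invfM aE !(lopE K) !ripE.
by rewrite ![a * (a^-1 * _)]mulrA a1 !mul1r.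
Qed.

End Polarization.

Lemma archi_le0 (R : realType) (a b : R) :
  (forall n, n.+1%:R * a <= b) -> a <= 0.
Proof.
move=> h; rewrite leNgt; apply/negP => a0.
have [n] : exists n, b / a < n.+1%:R.
  exists (Num.Def.truncn (b / a)); exact: truncnS_gt.
by rewrite ltr_pdivrMr // ltNge h.
Qed.

(** * Energy estimates for the Cayley transform *)

Section Cayley.
Variables (R : realType) (H : completeNormedModType R[i]).
Variable ip : {dot H for (@Num.conj R[i])}.
Hypothesis ip_norm : forall u : H, `|u| ^+ 2 = ip u u.
Local Notation r := (rip ip).
Local Notation q := (sqn ip).
Let q_ge0 u : 0 <= q u := sqn_ge0 ip_norm u.
Local Hint Resolve q_ge0 : core.

Variables L A : {linear H -> H}.
Hypothesis L_acc : forall x, 0 <= r (L x) x.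
Hypothesis L2_acc : forall x, 0 <= r (L (L x)) x.
Hypothesis A_right : forall x, A x + L (A x) = x.
Hypothesis A_left : forall x, A (x + L x) = x.

(** The Cayley transform (1 - L) (1 + L)^-1. Its powers replace the semigroup
    generated by - L, and keep the exact energy identities of the latter. *)
Definition cayley (x : H) : H := A x - L (A x).

Local Notation C := cayley.
Local Notation Cn n := (iter n C).
Local Notation dissip x := (q (L x) + r (L (L x)) x).

Lemma resolvent_comm x : A (L x) = L (A x).
Proof. by rewrite -{1}(A_right x) lopD A_left. Qed.

Lemma cayley_commL x : C (L x) = L (C x).
Proof. by rewrite /cayley !(lopE L) !resolvent_comm. Qed.

Lemma cayley_commA x : C (A x) = A (C x).
Proof. by rewrite /cayley !(lopE A) !resolvent_comm. Qed.

Lemma iter_commL n x : Cn n (L x) = L (Cn n x).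
Proof. by elim: n => //= n ->; rewrite cayley_commL. Qed.

Lemma iter_commA n x : Cn n (A x) = A (Cn n x).
Proof. by elim: n => //= n ->; rewrite cayley_commA. Qed.

(** The discrete form of (|w|^2)' = - 2 Re <L w, w> for w' = - L w. Here
    x = (1 + L) v and C x = (1 - L) v with v = A x. *)
Lemma cayley_sqn x : q (C x) = q x - 4 * r (L (A x)) (A x).
Proof.
rewrite -[in q x](A_right x) /cayley sqnB sqnD (ripC _ (A x)); ring.
Qed.

(** The discrete form of (Re <L w, w>)' = - |L w|^2 - Re <L^2 w, w>. *)
Lemma cayley_rho x :
  r (L (C x)) (C x)
  = r (L x) x - 2 * (q (L (A x)) + r (L (L (A x))) (A x)).
Proof.
rewrite -[in r (L x) x](A_right x) /cayley !(lopE L).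
move: (A x) => v; rewrite /sqn !ripE; ring.
Qed.

Lemma resolvent_contr x : q (A x) <= q x.
Proof.
rewrite -[in leRHS](A_right x) sqnD.
by have := L_acc (A x); have := q_ge0 (L (A x)); rewrite ripC; lra.
Qed.

Lemma resolventL_contr x : q (L (A x)) <= q x.
Proof.
rewrite -[in leRHS](A_right x) sqnD.
by have := L_acc (A x); have := q_ge0 (A x); rewrite ripC; lra.
Qed.

Lemma cayley_contr x : q (C x) <= q x.
Proof. by rewrite cayley_sqn; have := L_acc (A x); lra. Qed.

Lemma iter_contr n x : q (Cn n x) <= q x.
Proof. by elim: n => //= n; exact: le_trans (cayley_contr _). Qed.

(** With w the orbit of f and v = A w, the quantity |w|^2 / 4 + n Re <L v,
    v> decreases along the orbit: the loss of its first term at each step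
    pays for the new unit in the factor n. The sum of the losses is the left
    hand side. *)
Lemma smoothing_sum N f :
  \sum_(n < N) n.+1%:R * dissip (A (A (Cn n f))) <= q f / 8.
Proof.
pose F n := q (Cn n f) / 4 + n%:R * r (L (A (Cn n f))) (A (Cn n f)).
suff : \sum_(n < N) 2 * (n.+1%:R * dissip (A (A (Cn n f)))) = F 0%N - F N.
  rewrite -mulr_sumr /F /= mul0r => e.
  have := q_ge0 (Cn N f); have := mulr_ge0 (ler0n R N) (L_acc (A (Cn N f))).
  by lra.
elim: N => [|N IH]; first by rewrite big_ord0 subrr.
rewrite big_ord_recr /= IH /F /= -cayley_commA cayley_rho cayley_sqn.
by rewrite -natr1; field.
Qed.

(** The analogue of the bound |L e^(-tL)| <= c / t: the terms of the
    convergent sum above are monotone. *)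
Lemma smoothing n f : n.+1%:R ^+ 2 * q (L (A (A (Cn n f)))) <= q f.
Proof.
case: n => [|n].
  rewrite expr1n mul1r; apply: (le_trans (resolventL_contr _)).
  exact: resolvent_contr.
pose a k := q (L (A (A (Cn k f)))).
have anti m k : (m <= k)%N -> a k <= a m.
  elim: k => [|k IH]; first by rewrite leqn0 => /eqP ->.
  rewrite leq_eqVlt => /predU1P[-> //|/IH]; apply: le_trans.
  by rewrite /a /= -!cayley_commA -cayley_commL cayley_contr.
have := smoothing_sum n.+2 f.
have : \sum_(k < n.+2) k.+1%:R * a n.+1
    <= \sum_(k < n.+2) k.+1%:R * dissip (A (A (Cn k f))).
  apply: ler_sum => k _; apply: ler_wpM2l; first exact: ler0n.
  apply: (le_trans (anti k n.+1 _)); first by rewrite -ltnS ltn_ord.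
  by rewrite /a lerDl.
rewrite -mulr_suml; move=> /le_trans h /h {h}.
have -> : \sum_(k < n.+2) (k.+1%:R : R) = n.+2%:R * n.+3%:R / 2.
  elim: n.+2 => [|k IH]; first by rewrite big_ord0 mul0r mul0r.
  by rewrite big_ord_recr /= IH -!natr1; field.
rewrite -/(a n.+1) -[n.+3]addn1 natrD => h.
have := q_ge0 f.
have := mulr_ge0 (ler0n R n.+2) (q_ge0 (L (A (A (Cn n.+1 f))))).
rewrite -/(a n.+1) expr2 => *; lra.
Qed.

(** The estimate for L^2 is the product of two estimates for L, each with half
    of the time. *)
Lemma smoothing2 n f :
  n.+1%:R ^+ 4 * q (L (L (A (A (A (A (Cn n f))))))) <= 16 * q f.
Proof.
have [k [l [-> hk hl]]] : exists k l,
    [/\ n = (k + l)%N, (n.+1 <= 2 * k.+1)%N & (n.+1 <= 2 * l.+1)%N].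
  by exists n./2, (n - n./2)%N; have := odd_double_half n; move: (n./2) => m;
     case: (odd n) => e; split; lia.
have -> : L (L (A (A (A (A (Cn (k + l) f))))))
    = L (A (A (Cn k (L (A (A (Cn l f))))))).
  by rewrite !iter_commL !iter_commA !resolvent_comm iterD.
set g := L (A (A (Cn l f))).
have h1 := smoothing k g; have h2 := smoothing l f.
have h3 : (k + l).+1%:R ^+ 2 <= 4 * (k.+1%:R * l.+1%:R) :> R.
  rewrite -!natrM -natrX ler_nat -mulnn.
  by move: (leq_mul hk hl); lia.
have h4 : (k + l).+1%:R ^+ 4 <= 16 * (k.+1%:R ^+ 2 * l.+1%:R ^+ 2) :> R.
  have -> : 16 * (k.+1%:R ^+ 2 * l.+1%:R ^+ 2)
    = (4 * (k.+1%:R * l.+1%:R)) ^+ 2 :> R by ring.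
  by rewrite (exprM _ 2 2) ler_sqr // nnegrE ?exprn_ge0 ?mulr_ge0.
apply: (le_trans (ler_wpM2r (q_ge0 _) h4)).
move: h1 h2 (ler0n R k.+1) (ler0n R l.+1); rewrite -/g.
move: (q f) (q g) (q (L _)) (k.+1%:R : R) (l.+1%:R : R).
move=> x y z a b h1 h2 a0 b0.
have := ler_wpM2l (exprn_ge0 2 b0) h1; lra.
Qed.

(** The form Re <(L* - L) x, y>, written without the adjoint. *)
Definition adjdiff (x y : H) : R := r x (L y) - r (L x) y.

(** Write M = L* - L. The Lyapunov equation L* M + M L = (L^2)* - L^2
    becomes a Stein equation for the Cayley transform, so that iterating it
    expresses M through the imaginary part of L^2 alone. *)
Lemma adjdiff_cayley w z :
  adjdiff w z = adjdiff (C w) (C z)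
    + 2 * (r (A w) (L (L (A z))) - r (L (L (A w))) (A z)).
Proof.
rewrite -[in LHS](A_right w) -[in LHS](A_right z) /adjdiff /cayley !(lopE L).
move: (A w) (A z) => x y.
by rewrite !ripE; ring.
Qed.

Lemma adjdiff_sum N f g :
  adjdiff f g = adjdiff (Cn N f) (Cn N g) + \sum_(n < N)
    2 * (r (A (Cn n f)) (L (L (A (Cn n g))))
         - r (L (L (A (Cn n f)))) (A (Cn n g))).
Proof.
elim: N => [|N IH]; first by rewrite big_ord0 addr0.
by rewrite big_ord_recr /= IH (adjdiff_cayley (Cn N f)); ring.
Qed.

End Cayley.

(** * Comparing an accretive square root with its adjoint *)

Section SquareRootComparison.
Variables (R : realType) (H : completeNormedModType R[i]).
Variable ip : {dot H for (@Num.conj R[i])}.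
Hypothesis ip_norm : forall u : H, `|u| ^+ 2 = ip u u.
Local Notation r := (rip ip).
Local Notation q := (sqn ip).
Let q_ge0 u : 0 <= q u := sqn_ge0 ip_norm u.
Local Hint Resolve q_ge0 : core.

Variables L A : {linear H -> H}.
Hypothesis L_acc : forall x, 0 <= r (L x) x.
Hypothesis L2_acc : forall x, 0 <= r (L (L x)) x.
Hypothesis A_right : forall x, A x + L (A x) = x.
Hypothesis A_left : forall x, A (x + L x) = x.
Variable l : R.
Hypothesis l_ge0 : 0 <= l.
Hypothesis L_bnd : forall x, q (L x) <= l * q x.

Local Notation C := (cayley L A).
Local Notation Cn n := (iter n C).
Local Notation adjdiff := (adjdiff ip L).
Let contr := resolvent_contr ip_norm L_acc A_right.
Let icontr := iter_contr L_acc A_right.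
Let commL := iter_commL A_right A_left.
Let commA := iter_commA A_right A_left.
Let comm := resolvent_comm A_right A_left.
Let smooth := smoothing ip_norm L_acc L2_acc A_right A_left.

(** The difference X = M - L of two roots satisfies M X = - X L, so that |X
    w| does not decrease along the Cayley iteration of L. That iteration
    tends to 0 on the range of L; hence X L = 0, then M X = 0. *)
Lemma accretive_sqrt_unique (M : {linear H -> H}) (m : R) : 0 <= m ->
  (forall x, 0 <= r (M x) x) -> (forall x, q (M x) <= m * q x) ->
  (forall x, M x = 0 -> x = 0) -> (forall x, M (M x) = L (L x)) ->
  forall x, M x = L x.
Proof.
move=> m0 M_acc M_bnd M_inj M2 x.
pose X u := M u - L u.
have XM u : M (X u) = - X (L u) by rewrite /X !(lopE M) M2 opprB addrC.
have XD u v : X (u + v) = X u + X v.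
  by rewrite /X (lopD M) (lopD L) opprD addrACA.
have XN u : X (- u) = - X u by rewrite /X (lopN M) (lopN L) opprD.
have mono u : q (X u) <= q (X (C u)).
  rewrite -{1}(A_right u) /cayley !XD XN.
  have -> : X (L (A u)) = - M (X (A u)) by rewrite XM opprK.
  rewrite opprK; move: (X (A u)) => v; rewrite sqnB sqnD.
  by have := M_acc v; rewrite ripC; lra.
have monon n u : q (X u) <= q (X (Cn n u)).
  by elim: n => //= n IH; apply: (le_trans IH).
have X0 u : X (L u) = 0.
  pose f := (u + L u) + L (u + L u).
  have -> : u = A (A f) by rewrite /f !A_left.
  apply: (sqn_eq0 ip_norm); apply/eqP; rewrite eq_le q_ge0 andbT.
  apply: (archi_le0 (b := (2 * m + 2 * l) * q f)) => n.
  have := smooth n f; rewrite -!commA -commL.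
  have := monon n (L (A (A f))).
  set w := Cn n _ => h1 h2.
  have h3 : q (X w) <= (2 * m + 2 * l) * q w.
    apply: (le_trans (sqnD_le ip_norm _ _)); rewrite sqnN.
    by have := M_bnd w; have := L_bnd w; lra.
  have n1 : 1 <= n.+1%:R :> R by rewrite ler1n.
  apply: (le_trans (ler_wpM2l (ler0n R n.+1) (le_trans h1 h3))).
  rewrite mulrCA ler_wpM2l ?addr_ge0 ?mulr_ge0 //; apply: le_trans h2.
  by rewrite ler_wpM2r // ler_eXnr.
have /M_inj : M (X x) = 0 by rewrite XM X0 oppr0.
by move/eqP; rewrite subr_eq0 => /eqP.
Qed.

Lemma adjdiff_antisym y z : adjdiff y z = - adjdiff z y.
Proof. by rewrite /adjdiff (ripC _ z) (ripC _ (L z)); ring. Qed.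

Lemma adjdiffNl y z : adjdiff (- y) z = - adjdiff y z.
Proof. by rewrite /adjdiff !(lopE L) !ripE; ring. Qed.

Lemma adjdiff_sqr y : r (L (L y)) y = q (L y) + adjdiff (- L y) y.
Proof.
by rewrite adjdiffNl adjdiff_antisym /adjdiff (ripC _ (L (L y))) /sqn; ring.
Qed.

Variables (b : nat -> R) (s : R).
Hypothesis b_ge0 : forall n, 0 <= b n.
Hypothesis b_le : forall n, b n <= b 0%N.
Hypothesis b_sum : forall N, \sum_(n < N) b n / n.+1%:R <= s.
Hypothesis L2_im : forall n x,
  `|r (L (L x)) (jmul x)| <= b n * (r (L (L x)) x + n.+1%:R ^+ 2 * q (L (L x))).

Let s_ge0 : 0 <= s.
Proof. by have := b_sum 0; rewrite big_ord0. Qed.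

(** The remainder in the iterated Stein identity tends to 0, since each of its
    two products has a factor L C^N. *)
Lemma adjdiff_remainder N f g :
  N.+1%:R * adjdiff (Cn N (A (A f))) (Cn N (A (A g)))
  <= (q (A (A f)) + q g) / 2 + (q (A (A g)) + q f) / 2.
Proof.
have n0 : 0 < N.+1%:R :> R by rewrite ltr0n.
have key u v : 2 * `|r (Cn N u) (L (Cn N (A (A v))))|
    <= (q u + q v) / N.+1%:R.
  apply: (le_trans (rip_young ip_norm _ _ (t := N.+1%:R^-1) _)).
    by rewrite invr_gt0.
  rewrite invrK mulrDl mulrC lerD //.
    by rewrite ler_wpM2r ?invr_ge0 // iter_contr.
  by rewrite ler_pdivlMr // mulrAC -expr2 !commA smooth.
rewrite mulrC -ler_pdivlMr // /adjdiff (ripC _ (L _)).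
have := key (A (A f)) g; have := key (A (A g)) f.
move: (r _ _) (r _ _) => x y h1 h2.
apply: (le_trans (ler_norm _)); apply: (le_trans (ler_normB _ _)).
rewrite mulrDl ![_ / 2 / _]mulrAC.
move: h1 h2; move: ((q _ + q _) / _) ((q (A (A g)) + _) / _) => c d h1 h2; lra.
Qed.

(* The weight (n+1) nu in the polarized estimate balances the two orbits: L^2
   is of order |f| / n^2 on the first one and |L g| / n on the second. *)
Let step_sum (nu m : R) f g N : 0 < nu -> 0 <= m ->
  (forall n, r (L (L (A (Cn n (A g))))) (A (Cn n (A g))) <= 1 + m) ->
  q (L g) <= 2 * (1 + l) ->
  \sum_(n < N) 2 * (r (A (Cn n (A (A (A f))))) (L (L (A (Cn n (A g)))))
                    - r (L (L (A (Cn n (A (A (A f))))))) (A (Cn n (A g))))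
  <= nu * (2 * (b 0%N / 8 + 16 * s) * q f) + nu^-1 * (2 * s * (3 + 2 * l + m)).
Proof.
move=> nu0 m0 hm hg.
pose x n := A (Cn n (A (A (A f)))); pose y n := A (Cn n (A g)).
pose k n := q (L (x n)) + r (L (L (x n))) (x n).
have term n : 2 * (r (x n) (L (L (y n))) - r (L (L (x n))) (y n))
   <= 2 * nu * b 0%N * (n.+1%:R * k n)
      + (32 * nu * q f + 2 * nu^-1 * (3 + 2 * l + m)) * (b n / n.+1%:R).
  pose K : {linear H -> H} := (L \o L)%FUN.
  have n0 : 0 < n.+1%:R :> R by rewrite ltr0n.
  have := polarization (K := K) (L2_im n) (x n) (y n) (mulr_gt0 n0 nu0).
  rewrite /K /= invfM.
  have : n.+1%:R ^+ 4 * q (L (L (x n))) <= 16 * q f.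
    by rewrite /x !commA (smoothing2 ip_norm).
  have : n.+1%:R ^+ 2 * q (L (L (y n))) <= 2 * (1 + l).
    have -> : L (L (y n)) = L (A (A (Cn n (L g)))).
      by rewrite /y commA commL !comm.
    exact: le_trans hg.
  move: (hm n) (b_ge0 n) (b_le n) (q_ge0 (L (x n))) (L2_acc (x n)).
  rewrite -/(y n) /k; move: (q (L (x n))) (r (L (L (x n))) (x n)) => d kx.
  move: (r (L (L (y n))) (y n)) (q (L (L (x n)))) (q (L (L (y n)))) => ky a a'.
  have ni : n.+1%:R * n.+1%:R^-1 = 1 :> R by rewrite divff ?gt_eqF.
  have ci : 0 < n.+1%:R^-1 :> R by rewrite invr_gt0.
  have vi : 0 < nu^-1 by rewrite invr_gt0.
  move: (b n) (b 0%N) (n.+1%:R : R) (n.+1%:R^-1 : R) (nu^-1) n0 ni ci vi.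
  move=> B b0 t c v t0 tc c0 v0 hky B0 Bb d0 kx0 ha' ha hp.
  have e1 : B * (t * nu * kx) <= b0 * (t * nu * (d + kx)).
    have tn : 0 <= t * nu by rewrite mulr_ge0 // ltW.
    by apply: ler_pM => //; [rewrite mulr_ge0 | rewrite ler_wpM2l // lerDr].
  have e2 : B * (t * nu * (t ^+ 2 * a)) <= B * (nu * (c * (16 * q f))).
    apply: ler_wpM2l => //.
    have -> : t * nu * (t ^+ 2 * a) = nu * (c * (t ^+ 4 * a)).
      transitivity ((t * c) * (t * nu * (t ^+ 2 * a))); last by ring.
      by rewrite tc mul1r.
    by rewrite !ler_wpM2l // ltW.
  have e3 : B * (c * v * (ky + t ^+ 2 * a')) <= B * (c * v * (3 + 2 * l + m)).
    apply: ler_wpM2l => //; apply: ler_wpM2l; first by rewrite mulr_ge0 // ltW.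
    by move: hky ha'; lra.
  by move: hp e1 e2 e3; lra.
apply: (@le_trans _ _ (\sum_(n < N) (2 * nu * b 0%N * (n.+1%:R * k n)
      + (32 * nu * q f + 2 * nu^-1 * (3 + 2 * l + m)) * (b n / n.+1%:R)))).
  by apply: ler_sum => n _; exact: term.
rewrite big_split /= -!mulr_sumr.
have e : \sum_(n < N) n.+1%:R * k n <= q f / 8.
  have := smoothing_sum ip_norm L_acc A_right A_left N (A (A f)).
  under eq_bigr do rewrite -[A (Cn _ _)]commA.
  move=> h; apply: (le_trans h); rewrite ler_wpM2r ?invr_ge0 //.
  by apply: (le_trans (contr _)); exact: contr.
have h2 := ler_wpM2l (mulr_ge0 (mulr_ge0 (ler0n _ 2) (ltW nu0)) (b_ge0 0)) e.
have h3 : 0 <= 32 * nu * q f + 2 * nu^-1 * (3 + 2 * l + m).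
  have vi : 0 <= nu^-1 by rewrite invr_ge0 ltW.
  have k0 : 0 <= 3 + 2 * l + m by move: l_ge0 m0; lra.
  have := mulr_ge0 (ltW nu0) (q_ge0 f); have := mulr_ge0 vi k0; lra.
have h4 := ler_wpM2l h3 (b_sum N).
by move: h2 h4; lra.
Qed.

(* All vectors are in the range of A^3, since 1 + L is bounded. The value
   4 s + 1 of nu makes the coefficient of m at most 1/2. *)
Let root_bound_step (m : R) y z : 0 <= m ->
  (forall n, r (L (L (A (Cn n y)))) (A (Cn n y)) <= 1 + m) ->
  q (L y) <= 1 -> q z <= 1 ->
  adjdiff z y <= (4 * s + 1) * (2 * (b 0%N / 8 + 16 * s) * (2 * (1 + l)) ^+ 3)
                 + (3 + 2 * l + m) / 2.
Proof.
move=> m0 hm hy hz.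
have shift u : q (u + L u) <= 2 * (1 + l) * q u.
  by have := sqnD_le ip_norm u (L u); have := L_bnd u; lra.
have A_surj u : exists2 v, A v = u & q v <= 2 * (1 + l) * q u.
  by exists (u + L u).
have c0 : 0 <= 2 * (1 + l) by move: l_ge0; lra.
have [f1 e1 h1] := A_surj z; have [f2 e2 h2] := A_surj f1.
have [f e3 h3] := A_surj f2.
have [g f4 h4] := A_surj y; have [g' f5 _] := A_surj g.
have hg : q (L g) <= 2 * (1 + l).
  have -> : L g = L y + L (L y) by rewrite -(lopD L) -f4 A_right.
  apply: (le_trans (shift _)); rewrite -[leRHS]mulr1; exact: ler_wpM2l.
have hf : q f <= (2 * (1 + l)) ^+ 3.
  apply: (le_trans h3); rewrite exprS ler_wpM2l //.
  apply: (le_trans h2); rewrite exprS ler_wpM2l //.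
  by apply: (le_trans h1); rewrite expr1 -[leRHS]mulr1 ler_wpM2l.
have nu0 : 0 < 4 * s + 1 by move: s_ge0; lra.
subst z f1 f2 y g; rewrite -subr_le0.
set B := _ + _ / 2.
apply: (archi_le0 (b := (q (A (A (A f))) + q g') / 2
                        + (q (A (A g')) + q (A f)) / 2)) => N.
have h5 := adjdiff_remainder N (A f) g'.
have h6 : adjdiff (A (A (A f))) (A (A g'))
    <= adjdiff (Cn N (A (A (A f)))) (Cn N (A (A g'))) + B.
  rewrite (adjdiff_sum ip A_right N) lerD2l.
  apply: (le_trans (step_sum f N nu0 m0 hm hg)); rewrite /B.
  have nu1 : (4 * s + 1) * (4 * s + 1)^-1 = 1 by rewrite divff ?gt_eqF.
  have nui : 0 < (4 * s + 1)^-1 by rewrite invr_gt0.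
  apply: lerD.
    apply: ler_wpM2l; first exact: ltW.
    apply: ler_wpM2l => //; have := b_ge0 0; move: s_ge0; lra.
  have k0 : 0 <= 3 + 2 * l + m by move: l_ge0 m0; lra.
  by rewrite -(ler_pM2l nu0) mulrA nu1; lra.
apply: le_trans h5; rewrite ler_wpM2l //.
by move: h6; lra.
Qed.

(** The terms of the iterated Stein identity contain Re <L^2 y, y> for y on
    the orbit, which equals |L y|^2 plus a value of the form to be
    estimated. The set of y with |L y| <= 1 is invariant under the
    iteration, so the supremum of the form over it is at most a constant
    plus half of itself. *)
Lemma adjdiff_bounded : exists2 G, 0 <= G &
  forall y z, q (L y) <= 1 -> q z <= 1 -> adjdiff z y <= G.
Proof.
pose D := (4 * s + 1) * (2 * (b 0%N / 8 + 16 * s) * (2 * (1 + l)) ^+ 3).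
have D0 : 0 <= D.
  have := b_ge0 0; move: l_ge0 s_ge0 => l0 s0 b0.
  by rewrite /D !mulr_ge0 ?exprn_ge0 //; lra.
exists (2 * D + 3 + 2 * l); first by move: D0 l_ge0; lra.
move=> y z hy hz.
(* The bound on |y| serves to make the supremum finite. *)
pose E : set R := [set e | exists y1 z1,
  [/\ q (L y1) <= 1, q y1 <= q y, q z1 <= 1 & e = adjdiff z1 y1]].
have Eub : ubound E ((2 + l + q y) / 2).
  move=> _ [y1 [z1 [h1 h2 h3 ->]]]; rewrite /adjdiff.
  have := rip_young ip_norm z1 (L y1) ltr01.
  have := rip_young ip_norm (L z1) y1 ltr01.
  rewrite invr1 !mul1r => k1 k2.
  have := ler_norm (r z1 (L y1)); have := ler_norm (- r (L z1) y1).
  rewrite normrN.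
  have := le_trans (L_bnd z1) (ler_wpM2l l_ge0 h3); rewrite mulr1; lra.
have q0 : q 0 = 0 by rewrite /sqn rip0l.
have E0 : E 0.
  exists 0, 0; rewrite (lop0 L) q0; split=> //.
  by rewrite /adjdiff rip0l (lop0 L) rip0l subrr.
have Es : has_sup E by split; [exists 0 | exists ((2 + l + q y) / 2)].
have le_sup e : E e -> e <= sup E.
  exact: (sup_upper_bound Es).
have m0 : 0 <= sup E by exact: le_sup.
have : sup E <= D + (3 + 2 * l + sup E) / 2.
  apply: ge_sup; first by exists 0.
  move=> _ [y1 [z1 [h1 h2 h3 ->]]]; apply: root_bound_step => // n.
  have k1 : q (L (A (Cn n y1))) <= 1.
    rewrite -commA -commL; apply: le_trans h1; rewrite -comm.
    by apply: (le_trans (icontr _ _)); exact: contr.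
  rewrite adjdiff_sqr lerD //; apply: le_sup.
  exists (A (Cn n y1)), (- L (A (Cn n y1))); split=> //; last by rewrite sqnN.
  apply: le_trans h2.
  by apply: (le_trans (contr _)); exact: icontr.
have := @le_sup (adjdiff z y); rewrite -/D => h1 h2.
have {}h1 : adjdiff z y <= sup E by apply: h1; exists y, z.
by move: h1 h2; lra.
Qed.

End SquareRootComparison.

(** * Riesz representation, adjoints and resolvents *)

Section Hilbert.
Variables (R : realType) (H : completeNormedModType R[i]).
Variable ip : {dot H for (@Num.conj R[i])}.
Hypothesis ip_norm : forall u : H, `|u| ^+ 2 = ip u u.
Local Notation r := (rip ip).
Local Notation q := (sqn ip).
Let q_ge0 u : 0 <= q u := sqn_ge0 ip_norm u.
Local Hint Resolve q_ge0 : core.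

Lemma norm_lt_sqn (u : H) (e : R) : 0 < e -> (`|u| < e%:C) = (q u < e ^+ 2).
Proof.
move=> e0; rewrite -(ltr_pXn2r (n := 2)) ?nnegrE ?ler0c ?(ltW e0) //.
by rewrite (sqn_norm ip_norm) -rmorphXn ltcR.
Qed.

Lemma norm_le_sqn (u v : H) (c : R) : 0 <= c ->
  (`|u| <= c%:C * `|v|) = (q u <= c ^+ 2 * q v).
Proof.
move=> c0; rewrite -(ler_pXn2r (n := 2)) ?nnegrE ?mulr_ge0 ?ler0c //.
by rewrite exprMn !(sqn_norm ip_norm) -rmorphXn -rmorphM lecR.
Qed.

Lemma sqn_complete (x : nat -> H) :
  (forall n m, (n <= m)%N -> q (x m - x n) <= 4 / n.+1%:R) ->
  exists w, forall e : R, 0 < e ->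
    exists N, forall n, (N <= n)%N -> q (w - x n) < e.
Proof.
move=> xC.
have small (e : R) : 0 < e -> exists N, 4 / N.+1%:R < e.
  move=> e0; exists (Num.Def.truncn (4 / e)).
  by rewrite ltr_pdivrMr // mulrC -ltr_pdivrMr // truncnS_gt.
have cx : cvg (x n @[n --> \oo]).
  apply: cauchy_cvg; apply: cauchy_exP => e e0.
  have [a [a0 ->]] : exists a : R, 0 < a /\ e = a%:C.
    exists (complex.Re e); move: e0; case: e => a b.
    by rewrite ltcE /= => /andP[/eqP -> ].
  have [N hN] := small _ (exprn_gt0 2 a0).
  exists (x N); exists N => // n /= Nn.
  rewrite -ball_normE /= norm_lt_sqn //.
  by rewrite -(sqnN ip) opprB; apply: le_lt_trans hN; exact: xC.
exists (lim (x n @[n --> \oo])) => e e0.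
pose a := Num.sqrt e; have a0 : 0 < a by rewrite sqrtr_gt0.
have : (0 : R[i]) < a%:C by rewrite ltcR.
move/(cvgr_dist_lt _ _ cx) => [N _ hN]; exists N => n /hN /=.
by rewrite norm_lt_sqn // sqr_sqrtr // ltW.
Qed.

(** The representing vector is the limit of a minimizing sequence of q (T x)
    - 2 phi x, a Cauchy sequence by the parallelogram identity. The bound of
    phi by T rather than by the identity serves three purposes: it solves
    equations for the adjoint of T, gives the density of the range of T, and
    factors one operator through another. *)
Lemma riesz (T : {linear H -> H}) (phi : H -> R) (c : R) :
  (forall x y, phi (x + y) = phi x + phi y) ->
  (forall (a : R) x, phi (a%:C *: x) = a * phi x) ->
  (forall x, 2 * phi x <= q (T x) + c) ->
  exists w, (forall x, phi x = r (T x) w) /\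
            (forall e : R, 0 < e -> exists x, q (w - T x) < e).
Proof.
move=> phiD phiZ phi_bnd.
pose J x := q (T x) - 2 * phi x.
have [m [m_le xP]] : exists m : R, (forall x, m <= J x) /\
    (forall n, exists x, J x < m + n.+1%:R^-1).
  have Elb : has_lbound (range J).
    by exists (- c) => _ [x _ <-]; rewrite /J; have := phi_bnd x; lra.
  have Ei : has_inf (range J) by split=> //; exists (J 0); exists 0.
  exists (inf (range J)); split=> [x|n]; first by apply: (ge_inf Elb); exists x.
  have n0 : 0 < n.+1%:R^-1 :> R by rewrite invr_gt0.
  by have [_ [x _ <-] h] := inf_adherent n0 Ei; exists x.
have [x hx] := choice xP.
have par y z : q (T y - T z) <= 2 * (J y - m) + 2 * (J z - m).
  have : m <= 4^-1 * q (T y + T z) - (phi y + phi z).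
    have -> : 4^-1 * q (T y + T z) - (phi y + phi z) = J (2^-1%:C *: (y + z)).
      by rewrite /J (lopZ T) sqnZ phiZ phiD (lopD T); field.
    exact: m_le.
  by rewrite /J sqnB sqnD; lra.
have inv_le n k : (n <= k)%N -> k.+1%:R^-1 <= n.+1%:R^-1 :> R.
  by move=> nk; rewrite lef_pV2 ?posrE // ler_nat.
have [w hw] : exists w, forall e : R, 0 < e ->
    exists N, forall n, (N <= n)%N -> q (w - T (x n)) < e.
  apply: sqn_complete => n k nk; apply: (le_trans (par _ _)).
  move: (hx n) (hx k) (inv_le _ _ nk).
  by move: (n.+1%:R^-1) (k.+1%:R^-1) => a b; lra.
exists w; split=> [y|e /hw[N hN]]; last by exists (x N); exact: hN.
pose d := r (T y) w - phi y; pose a := q (T y).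
have key (t : R) : 0 <= 2 * t ^+ 2 * a + 2 * t * d.
  suff h (e : R) : 0 < e -> 0 <= 2 * t ^+ 2 * a + 2 * t * d + e.
    by apply/ler_addgt0Pr.
  move=> e0.
  have e2 : 0 < e / 2 by lra.
  have [N hN] := hw _ e2.
  have [M hM] : exists M, M.+1%:R^-1 < e / 2.
    exists (Num.Def.truncn ((e / 2)^-1)).
    by rewrite invf_plt ?posrE // truncnS_gt.
  pose n := maxn N M.
  have h1 := hN n (leq_maxl _ _).
  have h2 := inv_le _ _ (leq_maxr N M).
  have h3 := hx n; have h4 := m_le (x n + t%:C *: y).
  have h5 := q_ge0 (w - T (x n) + t%:C *: T y).
  move: h1 h2 h3 h4 h5; rewrite -/n.
  rewrite /J /d /a (lopD T) (lopZ T) phiD phiZ !sqnD sqnZ !ripE.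
  rewrite (ripC _ w (T y)).
  move: hM; move: (M.+1%:R^-1) (n.+1%:R^-1) => i1 i2; lra.
(* Hence d = 0, by taking t = - d / (a + 1). *)
have a0 : 0 <= a := q_ge0 _.
apply/eqP; rewrite eq_sym -subr_eq0 -/d; apply/eqP.
have a1 : 0 < a + 1 by lra.
have := key (- d / (a + 1)).
have -> : 2 * (- d / (a + 1)) ^+ 2 * a + 2 * (- d / (a + 1)) * d
  = - (2 * d ^+ 2 / (a + 1) ^+ 2) by field; rewrite gt_eqF.
rewrite oppr_ge0 ler_pdivrMr ?exprn_gt0 // mul0r => h.
have : d ^+ 2 == 0 by rewrite eq_le sqr_ge0 andbT; lra.
by rewrite expf_eq0 => /eqP.
Qed.

Lemma linear_map (f : H -> H) :
  (forall (a : R[i]) u v, f (a *: u + v) = a *: f u + f v) ->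
  exists L : {linear H -> H}, forall u, L u = f u.
Proof.
move=> flin.
pose F : {linear H -> H} := HB.pack f (GRing.isLinear.Build _ _ _ _ f flin).
by exists F.
Qed.

Lemma adjoint_exists (L : {linear H -> H}) (c : R) : 0 <= c ->
  (forall x, q (L x) <= c * q x) ->
  exists L' : {linear H -> H},
    (forall x y, r (L x) y = r x (L' y)) /\ (forall y, q (L' y) <= c * q y).
Proof.
move=> c0 L_bnd.
have ex y : exists w, forall x, r (L x) y = r x w.
  have [||x|w [hw _]] := @riesz idfun (fun x => r (L x) y) ((c + 1) * q y).
  - by move=> u v; rewrite (lopD L) ripDl.
  - by move=> a u; rewrite (lopZ L) ripZl.
  - have c1 : 0 < c + 1 by lra.
    have ci : 0 < (c + 1)^-1 by rewrite invr_gt0.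
    have := rip_young ip_norm (L x) y ci; rewrite invrK.
    have h : (c + 1)^-1 * q (L x) <= q x.
      by rewrite ler_pdivrMl //; have := L_bnd x; have := q_ge0 x; lra.
    by have := ler_norm (r (L x) y); rewrite /=; lra.
  by exists w.
have [f hf] := choice ex.
have [L' hL'] : exists L' : {linear H -> H}, forall u, L' u = f u.
  apply: linear_map => a u v; apply: (rip_eq ip_norm) => x.
  rewrite ripDr -!hf ripDr -[a]conjcK -!ripZc -(lopZ L) hf.
  by rewrite -hf.
have adj x y : r (L x) y = r x (L' y) by rewrite hL' hf.
exists L'; split=> // y.
have h : q (L' y) * q (L' y) <= q (L' y) * (c * q y).
  have -> : q (L' y) * q (L' y) = r (L (L' y)) y ^+ 2 by rewrite adj.
  apply: (le_trans (cauchy_schwarz ip_norm _ _)).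
  by rewrite [leRHS]mulrCA [leRHS]mulrA ler_wpM2r.
have := q_ge0 (L' y); rewrite le_eqVlt => /predU1P[<-|h0].
  by rewrite mulr_ge0.
by rewrite -(ler_pM2l h0).
Qed.

Lemma accretive_shift_low (L : {linear H -> H}) (lam : R[i]) u :
  (forall x, 0 <= r (L x) x) -> 0 < complex.Re lam ->
  complex.Re lam ^+ 2 * q (L u) <= q (u + lam *: L u).
Proof.
move=> L_acc; set a := complex.Re lam => a0; set v := L u.
have h : a * q v <= r (u + lam *: v) v.
  have -> : lam *: v = a%:C *: v + (complex.Im lam)%:C *: jmul v.
    by rewrite /jmul scalerA -scalerDl {1}[lam]complexE [_ * 'i%C]mulrC.
  have := L_acc u; rewrite !ripE rip_jl -/v ripC.
  have -> : complex.Im (ip v v) = 0 by rewrite -ip_norm (sqn_norm ip_norm).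
  by rewrite /sqn; lra.
have h2 := cauchy_schwarz ip_norm (u + lam *: v) v.
have := q_ge0 v; rewrite le_eqVlt => /predU1P[<-|h0]; first by rewrite mulr0.
rewrite -(ler_pM2r h0); apply: le_trans h2.
have -> : a ^+ 2 * q v * q v = (a * q v) ^+ 2 by ring.
have h3 : 0 <= a * q v by rewrite mulr_ge0 // ltW.
by rewrite ler_sqr ?nnegrE // (le_trans h3 h).
Qed.

Section AdjointPair.
Variables L L' : {linear H -> H}.
Hypothesis adj : forall x y, r (L x) y = r x (L' y).
Hypothesis L_acc : forall x, 0 <= r (L x) x.

Lemma adj_sym x y : r (L' x) y = r x (L y).
Proof. by rewrite ripC -adj ripC. Qed.

Lemma adj_acc x : 0 <= r (L' x) x.
Proof. by rewrite adj_sym ripC. Qed.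

(** If L* z = 0, the nonnegative form Re <L x, x> vanishes at z, hence its
    first variation there vanishes too, which gives L z = 0. *)
Lemma adj_inj : (forall x, L x = 0 -> x = 0) -> forall z, L' z = 0 -> z = 0.
Proof.
move=> L_inj z hz; apply/L_inj/(sqn_eq0 ip_norm).
have key (t : R) : 0 <= t ^+ 2 * r (L (L z)) (L z) - t * q (L z).
  have := L_acc (z - t%:C *: L z).
  rewrite (lopD L) (lopN L) (lopZ L) !ripE [r (L z) z]adj hz rip0r.
  by rewrite [r (L (L z)) z]adj hz rip0r /sqn; congr (_ <= _); ring.
have c0 := L_acc (L z); have q0 := q_ge0 (L z).
move: (r _ _) (q _) key c0 q0 => c a key c0 a0.
apply/eqP; rewrite eq_le a0 andbT leNgt; apply/negP => ap.
have c1 : 0 < c + 1 by lra.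
have := key (a / (c + 1)).
have -> : (a / (c + 1)) ^+ 2 * c - a / (c + 1) * a = - (a / (c + 1)) ^+ 2.
  by field; rewrite gt_eqF.
by rewrite oppr_ge0 leNgt exprn_gt0 // divr_gt0.
Qed.

(** The adjoint of 1 + lam L is bounded below, so the functional <x, y> is
    bounded by it and the representing vector solves the equation. *)
Lemma resolvent_exists (lam : R[i]) : 0 < complex.Re lam ->
  forall y, exists w, w + lam *: L w = y.
Proof.
move=> lam0 y.
have [T hT] : exists T : {linear H -> H}, forall u, T u = u + conjc lam *: L' u.
  apply: linear_map => a u v.
  rewrite (lopD L') (lopZ L') !scalerDr !scalerA [conjc lam * a]mulrC.
  by rewrite addrACA.
set a := complex.Re lam in lam0.
have lowL u : a ^+ 2 * q (L' u) <= q (T u).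
  have aE : a = complex.Re (conjc lam) by rewrite /a; case: (lam).
  by rewrite hT aE; apply: accretive_shift_low; [exact: adj_acc | rewrite -aE].
pose m := complex.Re lam ^+ 2 + complex.Im lam ^+ 2.
pose d := 2 + 2 * m / a ^+ 2.
have m0 : 0 <= m by rewrite /m addr_ge0 ?sqr_ge0.
have a2 : 0 < a ^+ 2 by exact: exprn_gt0.
have d0 : 0 < d.
  have : 0 <= 2 * m / a ^+ 2.
    by apply: divr_ge0; [rewrite mulr_ge0 | exact: ltW].
  by rewrite /d; lra.
have low u : q u <= d * q (T u).
  have -> : q u = q (T u - conjc lam *: L' u) by rewrite hT addrK.
  apply: (le_trans (sqnD_le ip_norm _ _)).
  rewrite (sqnN ip) (sqnZc ip_norm).
  have -> : complex.Re (conjc lam) ^+ 2 + complex.Im (conjc lam) ^+ 2 = m.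
    by rewrite /m; case: (lam) => x z /=; rewrite sqrrN.
  have e : m * q (L' u) <= m / a ^+ 2 * q (T u).
    have -> : m * q (L' u) = m / a ^+ 2 * (a ^+ 2 * q (L' u)).
      by field; rewrite gt_eqF.
    by rewrite ler_wpM2l // divr_ge0 // ltW.
  by rewrite /d; move: (m / a ^+ 2) e (mulrA 2 m (a ^- 2)) => z e <-; lra.
have [||x|w [hw _]] := @riesz T (fun x => r x y) (d * q y).
- by move=> u v; rewrite ripDl.
- by move=> c u; rewrite ripZl.
- have di : 0 < d^-1 by rewrite invr_gt0.
  have := rip_young ip_norm x y di; rewrite invrK.
  have h : d^-1 * q x <= q (T x) by rewrite ler_pdivrMl.
  by have := ler_norm (r x y); lra.
exists w; apply: (rip_eq ip_norm) => x.
by rewrite hw hT !ripE ripZc conjcK adj_sym (lopZ L).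
Qed.

(** The vector representing <L x, f> on the range of L is f itself, and it
    is a limit of vectors of the range. *)
Lemma dense_range : (forall x, L' x = 0 -> x = 0) ->
  forall f (e : R), 0 < e -> exists x, q (f - L x) < e.
Proof.
move=> L'_inj f.
have [||x|w [hw hd]] := @riesz L (fun x => r (L x) f) (q f).
- by move=> u v; rewrite (lopD L) ripDl.
- by move=> a u; rewrite (lopZ L) ripZl.
- by have := q_ge0 (L x - f); rewrite sqnB; lra.
suff -> : f = w by [].
apply/eqP; rewrite -subr_eq0; apply/eqP/L'_inj/(rip_eq ip_norm) => x.
by rewrite -adj ripDr ripNr hw subrr rip0r.
Qed.

End AdjointPair.

End Hilbert.

(** * From the numerical range to the square root *)

Section ImaginaryPart.
Variables (R : realType) (H : completeNormedModType R[i]).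
Variable ip : {dot H for (@Num.conj R[i])}.
Hypothesis ip_norm : forall u : H, `|u| ^+ 2 = ip u u.
Local Notation r := (rip ip).
Local Notation q := (sqn ip).
Let q_ge0 u : 0 <= q u := sqn_ge0 ip_norm u.
Local Hint Resolve q_ge0 : core.

(** The numerical range condition for the inverse T of K, with u = K x:
    |Im <T u, u>| is at most b n times Re <T u, u> + (n+1)^2 |u|^2, at all
    scales n. The power of the real part is thus hidden in the decay of b. *)
Definition imag_bound (b : nat -> R) (K : H -> H) : Prop :=
  forall n x, `|r (K x) (jmul x)|
    <= b n * (r (K x) x + n.+1%:R ^+ 2 * q (K x)).

Lemma le_small (x y c : R) :
  (forall t, 0 < t -> t <= 1 -> x <= y + t * c) -> x <= y.
Proof.
move=> h; have h2 (e : R) : 0 < e -> x <= y + e.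
  move=> e0; pose t := Num.min 1 (e / (`|c| + 1)).
  have c1 : 0 < `|c| + 1 by rewrite ltr_wpDl.
  have t0 : 0 < t by rewrite /t lt_min ltr01 divr_gt0.
  apply: (le_trans (h t t0 _)); first by rewrite /t ge_min lexx.
  rewrite lerD2l.
  have : t * c <= t * (`|c| + 1).
    by rewrite ler_wpM2l ?(ltW t0) //; have := ler_norm c; lra.
  have : t * (`|c| + 1) <= e by rewrite -ler_pdivlMr // /t ge_min lexx orbT.
  by lra.
by apply/ler_addgt0Pr.
Qed.

Section Pair.
Variables K K' : {linear H -> H}.
Hypothesis adj : forall x y, r (K x) y = r x (K' y).
Hypothesis K_acc : forall x, 0 <= r (K x) x.

Lemma shift_exists (e : R) f : 0 < e -> exists z, K z + e%:C *: z = f.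
Proof.
move=> e0.
have l0 : 0 < complex.Re (e^-1)%:C by rewrite /= invr_gt0.
have [z hz] := resolvent_exists ip_norm adj K_acc l0 ((e^-1)%:C *: f).
exists z.
have := congr1 (fun u => e%:C *: u) hz.
have ee : e%:C * (e^-1)%:C = 1 :> R[i] by rewrite -rmorphM divff // gt_eqF.
by rewrite scalerDr !scalerA ee !scale1r addrC.
Qed.

Lemma shift_ge (e : R) z : 0 < e ->
  q (K z) <= q (K z + e%:C *: z) /\ q (e%:C *: z) <= q (K z + e%:C *: z).
Proof.
move=> e0; rewrite sqnD ripZr; have := mulr_ge0 (ltW e0) (K_acc z).
have := q_ge0 (K z); have := q_ge0 (e%:C *: z).
by split; lra.
Qed.

(** The domains of T and T* may differ, so their numerical ranges cannot be
    compared directly. But the condition on T passes to the bounded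
    operators (K + e)^-1, where it concerns the values of one form and its
    conjugate and so passes to the adjoints; then e tends to 0. *)
Lemma imag_bound_adjoint b : (forall n, 0 <= b n) ->
  imag_bound b K -> imag_bound b K'.
Proof.
move=> b_ge0 K_im n x; set s := n.+1%:R ^+ 2.
apply: (le_small (c := b n * (q x + s * (2 * r (K' x) x + q x)))) => t t0 t1.
have [u hu] := shift_exists (K' x + t%:C *: x) t0.
set f := K' x + t%:C *: x in hu.
have e1 : r (K u) u + t * q u = r (K' x) x + t * q x.
  have -> : r (K u) u + t * q u = r f u by rewrite -hu !ripE.
  rewrite ripC {1}/f ripDr -adj ripZr -[t * r u x]ripZl -ripDl hu.
  by rewrite /f !ripE.
have e2 : `|r (K u) (jmul u)| = `|r (K' x) (jmul x)|.
  have -> : r (K u) (jmul u) = r f (jmul u).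
    by rewrite -hu !ripE rip_j0 mulr0 addr0.
  rewrite (rip_jC ip f) normrN {1}/f jmulD -[jmul (K' x)](lop_jmul K').
  rewrite ripDr -adj.
  have -> : r u (jmul (t%:C *: x)) = r (t%:C *: u) (jmul x).
    by rewrite [LHS]rip_jC ripZl ripZl [r u _]rip_jC mulrN.
  by rewrite -ripDl hu /f !ripE rip_j0 mulr0 addr0.
have s0 : 0 <= s by exact: sqr_ge0.
have h1 : r (K u) u <= r (K' x) x + t * q x.
  by have := mulr_ge0 (ltW t0) (q_ge0 u); lra.
have h2 : q (K u) <= q (K' x) + t * (2 * r (K' x) x + q x).
  apply: (le_trans (shift_ge u t0).1); rewrite hu /f sqnD sqnZ ripZr.
  have : t ^+ 2 * q x <= t * q x by rewrite ler_wpM2r // expr2 ger_pMr.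
  by lra.
rewrite -e2; apply: (le_trans (K_im n u)).
have -> : b n * (r (K' x) x + s * q (K' x))
    + t * (b n * (q x + s * (2 * r (K' x) x + q x)))
  = b n * ((r (K' x) x + t * q x)
           + s * (q (K' x) + t * (2 * r (K' x) x + q x))).
  by ring.
by rewrite ler_wpM2l // lerD // ler_wpM2l.
Qed.

Hypothesis K_inj : forall x, K x = 0 -> x = 0.

(** The operators e (K + e)^-1 are contractions and are of order e on the
    range of K, which is dense. *)
Lemma shift_vanish f (t : R) : 0 < t ->
  exists (e : R) z, [/\ 0 < e, K z + e%:C *: z = f & q (e%:C *: z) <= t].
Proof.
move=> t0.
have [x hx] := dense_range ip_norm adj (adj_inj ip_norm adj K_acc K_inj) f
  (divr_gt0 t0 (ltr0Sn R 9)).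
pose e := Num.sqrt (t / 10 / (q x + 1)).
have x1 : 0 < q x + 1 by rewrite ltr_wpDl.
have e0 : 0 < e by rewrite sqrtr_gt0 !divr_gt0.
have e2 : e ^+ 2 * q x <= t / 10.
  rewrite sqr_sqrtr; last by rewrite ltW // !divr_gt0.
  by rewrite mulrAC ler_pdivrMr // ler_wpM2l ?divr_ge0 ?(ltW t0) //; lra.
have [z hz] := shift_exists f e0.
exists e, z; split=> //.
have -> : e%:C *: z = e%:C *: (z - x) + e%:C *: x by rewrite -scalerDr subrK.
have h1 := (shift_ge (z - x) e0).2.
have e3 : K (z - x) + e%:C *: (z - x) = (f - K x) - e%:C *: x.
  by rewrite -hz (lopD K) (lopN K) scalerBr addrACA addrA addrAC -addrA -addrA.
rewrite e3 in h1; have h2 := sqnD_le ip_norm (f - K x) (- (e%:C *: x)).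
rewrite (sqnN ip) in h2.
have h3 := sqnD_le ip_norm (e%:C *: (z - x)) (e%:C *: x).
move: h1 h2 h3 hx e2; rewrite (sqnZ ip e x).
by lra.
Qed.

End Pair.

Section SquareRoot.
Variables L L' : {linear H -> H}.
Hypothesis adj : forall x y, r (L x) y = r x (L' y).
Hypothesis L_acc : forall x, 0 <= r (L x) x.
Hypothesis L2_acc : forall x, 0 <= r (L (L x)) x.

Lemma resolvent_one : exists A : {linear H -> H},
  (forall x, A x + L (A x) = x) /\ (forall x, A (x + L x) = x).
Proof.
have ex x : exists w, w + L w = x.
  have := @resolvent_exists _ _ _ ip_norm _ _ adj L_acc 1 _ x.
  by move=> /(_ ltr01)[w]; rewrite scale1r => hw; exists w.
have inj u v : u + L u = v + L v -> u = v.
  move=> e; apply/eqP; rewrite -subr_eq0; apply/eqP/(sqn_eq0 ip_norm).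
  have e2 : (u - v) + L (u - v) = 0.
    by rewrite (lopD L) (lopN L) addrACA e -opprD subrr.
  have := congr1 (fun w => r w (u - v)) e2; rewrite ripDl rip0l.
  have := L_acc (u - v); have := q_ge0 (u - v); rewrite /sqn.
  by move: (r _ _) (r _ _) => *; lra.
have [f hf] := choice ex.
have [A hA] : exists A : {linear H -> H}, forall u, A u = f u.
  apply: linear_map => a u v; apply: inj.
  by rewrite hf (lopD L) (lopZ L) addrACA -scalerDr !hf.
exists A; split=> x; first by rewrite hA hf.
by apply: inj; rewrite hA hf.
Qed.

Section Ranges.
Variables (l : R) (b : nat -> R) (s : R).
Hypothesis l_ge0 : 0 <= l.
Hypothesis L_bnd : forall x, q (L x) <= l * q x.
Hypothesis b_ge0 : forall n, 0 <= b n.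
Hypothesis b_le : forall n, b n <= b 0%N.
Hypothesis b_sum : forall N, \sum_(n < N) b n / n.+1%:R <= s.
Hypothesis L2_im : imag_bound b (L \o L).

(** By the comparison of L with L*, |<x, L f>| is bounded by a multiple of
    |L x| + 1; hence it is represented as <L x, w>, that is, L f = L* w. *)
Lemma range_sub_adjoint f : exists w, L' w = L f.
Proof.
have [A [AL LA]] := resolvent_one.
have [G G0 hG] := adjdiff_bounded ip_norm L_acc L2_acc AL LA l_ge0 L_bnd
  b_ge0 b_le b_sum L2_im.
pose t := Num.sqrt (q f + 1).
have t0 : 0 < t by rewrite sqrtr_gt0 ltr_wpDl.
have tE : t ^+ 2 = q f + 1 by rewrite sqr_sqrtr // addr_ge0.
have ti : t * t^-1 = 1 by rewrite divff // gt_eqF.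
have bnd x : 2 * r x (L f) <= q (L x) + (1 + 2 * G ^+ 2 * t ^+ 2 + 2 * q f).
  pose a := Num.sqrt (q (L x) + 1).
  have a0 : 0 < a by rewrite sqrtr_gt0 ltr_wpDl.
  have aE : a ^+ 2 = q (L x) + 1 by rewrite sqr_sqrtr // addr_ge0.
  have ai : a * a^-1 = 1 by rewrite divff // gt_eqF.
  have h := hG (a^-1%:C *: x) (- (t^-1%:C *: f)).
  rewrite (lopZ L) (sqnN ip) !(sqnZ ip) in h.
  have {}h : a^-1 * t^-1 * (r x (L f) - r (L x) f) <= G.
    have -> : a^-1 * t^-1 * (r x (L f) - r (L x) f)
       = adjdiff ip L (- (t^-1%:C *: f)) (a^-1%:C *: x).
      rewrite /adjdiff !(lopN L) !(lopZ L) !ripE (ripC _ f (L x)).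
      rewrite (ripC _ (L f) x).
      by ring.
    apply: h; rewrite exprVn ler_pdivrMl ?exprn_gt0 // mulr1 ?aE ?tE; lra.
  have {}h : r x (L f) - r (L x) f <= G * (a * t).
    have -> : r x (L f) - r (L x) f
       = (a * t) * (a^-1 * t^-1 * (r x (L f) - r (L x) f)).
      transitivity ((a * a^-1) * (t * t^-1) * (r x (L f) - r (L x) f)).
        by rewrite ai ti !mul1r.
      by ring.
    by rewrite [leRHS]mulrC ler_wpM2l // mulr_ge0 // ltW.
  have h4 := sqr_ge0 (a - 2 * G * t).
  have h5 := q_ge0 (L x - 2%:C *: f).
  move: h h4 h5; rewrite sqnB (sqnZ ip) ripZr.
  rewrite sqrrB aE.
  by move: (r x _) (r (L x) f) (q f) (q (L x)) => *; lra.
have [||w [hw _]] := riesz ip_norm (phi := fun x => r x (L f)) _ _ bnd.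
- by move=> u v; rewrite ripDl.
- by move=> c u; rewrite ripZl.
by exists w; apply: (rip_eq ip_norm) => x; rewrite -adj -hw.
Qed.

End Ranges.

(** The value <f, g> is that of the form of T at u = L f = L* g. It is the
    limit of <(K + e)^-1 u, u>, to which the condition on T applies. *)
Lemma form_imag_bound b f g : (forall n, 0 <= b n) ->
  (forall x, L x = 0 -> x = 0) -> imag_bound b (L \o L) -> L f = L' g ->
  forall n, `|r f (jmul g)| <= b n * (r f g + n.+1%:R ^+ 2 * q (L f)).
Proof.
move=> b_ge0 L_inj L2_im efg n; set s := n.+1%:R ^+ 2.
pose K : {linear H -> H} := (L \o L)%FUN.
pose K' : {linear H -> H} := (L' \o L')%FUN.
have adjK x y : r (K x) y = r x (K' y) by rewrite /K /K' /= !adj.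
have K_inj x : K x = 0 -> x = 0 by move=> /L_inj/L_inj.
apply: (le_small (c := (1 + b n) * (1 + q g) / 2)) => t t0 t1.
have [e [z [e0 hz ez]]] := shift_vanish adjK L2_acc K_inj f (exprn_gt0 2 t0).
set d := e%:C *: z in hz ez.
have hd h : 2 * `|r d h| <= t * (1 + q h).
  have ti : 0 < t^-1 by rewrite invr_gt0.
  apply: (le_trans (rip_young ip_norm _ _ ti)).
  rewrite invrK mulrDr mulr1 lerD2r.
  by rewrite ler_pdivrMl // -expr2.
have eu : L f = L (L (L z)) + e%:C *: L z.
  by rewrite -hz (lopD L) /d (lopZ L).
have e1 : r (L (L (L z))) (L z) <= r f g - r d g.
  have -> : r f g - r d g = r (L (L z)) g by rewrite -hz /K /= !ripE; ring.
  rewrite [leRHS]adj -efg (ripC _ _ (L f)) {1}eu ripDl ripZl.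
  by rewrite lerDl; exact: mulr_ge0 (ltW e0) (q_ge0 (L z)).
have e2 : q (L (L (L z))) <= q (L f).
  by rewrite eu; exact: (shift_ge (K := K) L2_acc (L z) e0).1.
have e3 : `|r (L (L (L z))) (jmul (L z))| = `|r f (jmul g) - r d (jmul g)|.
  have -> : r f (jmul g) - r d (jmul g) = r (L (L z)) (jmul g).
    by rewrite -hz /K /= !ripE; ring.
  rewrite [in RHS]adj (lop_jmul L') -efg [in RHS]rip_jC normrN eu !ripE rip_j0.
  by rewrite mulr0 addr0.
have := L2_im n (L z); rewrite /= e3 -/s => h.
have h2 : `|r f (jmul g) - r d (jmul g)| <= b n * (r f g - r d g + s * q (L f)).
  by apply: (le_trans h); rewrite ler_wpM2l // lerD // ler_wpM2l // sqr_ge0.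
have h3 := hd g; have h4 := hd (jmul g); rewrite (sqnJ ip) in h4.
have h5 : `|r f (jmul g)| <= `|r f (jmul g) - r d (jmul g)| + `|r d (jmul g)|.
  by apply: (le_trans _ (ler_normD _ _)); rewrite subrK.
have h6 := ler_norm (- r d g); rewrite normrN in h6.
have h7 : b n * (- r d g) <= b n * (t * (1 + q g) / 2).
  by rewrite ler_wpM2l //; lra.
by move: h2 h4 h5 h7; lra.
Qed.

End SquareRoot.
End ImaginaryPart.

(** * Weights attached to the exponent of the region *)

Section Weights.
Variable R : realType.

(** This is (n+1)^(- eta). *)
Definition weight (eta : R) (n : nat) : R := expR (- eta * ln n.+1%:R).

Lemma weight_gt0 eta n : 0 < weight eta n.
Proof. exact: expR_gt0. Qed.

Lemma weight_le eta n : 0 <= eta -> weight eta n <= weight eta 0.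
Proof.
move=> e0; rewrite /weight ln1 mulr0 ler_expR mulNr oppr_le0.
by rewrite mulr_ge0 // ln_ge0 // ler1n.
Qed.

(** The sum of (n+1)^(-1-eta) is bounded by comparison with the telescoping
    sum of n^(-eta) - (n+1)^(-eta), the convexity of the exponential replacing
    the integral. *)
Lemma weight_sum eta N : 0 < eta ->
  \sum_(n < N) weight eta n / n.+1%:R <= 1 + eta^-1.
Proof.
move=> e0.
suff h M : \sum_(n < M.+1) weight eta n / n.+1%:R
    <= 1 + eta^-1 * (1 - weight eta M).
  case: N => [|N]; first by rewrite big_ord0 addr_ge0 // invr_ge0 ltW.
  apply: (le_trans (h N)); rewrite lerD2l ler_piMr ?invr_ge0 ?(ltW e0) //.
  by have := weight_gt0 eta N; lra.
elim: M => [|M IH].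
  by rewrite big_ord_recr big_ord0 /= /weight ln1 mulr0 expR0; lra.
rewrite big_ord_recr /=; apply: (le_trans (lerD IH (lexx _))).
rewrite -addrA lerD2l -lerBrDl -mulrBr.
rewrite [leRHS]mulrC ler_pdivlMr //.
pose x : R := M.+2%:R; pose y : R := M.+1%:R.
have x0 : 0 < x by rewrite ltr0n.
have y0 : 0 < y by rewrite ltr0n.
have xy : y = x - 1 by rewrite /x -natr1 addrK.
have hln : x^-1 <= ln x - ln y.
  rewrite -ln_div ?posrE // -[_ / _]invrK lnV ?posrE ?invr_gt0 ?divr_gt0 //.
  rewrite lerNr invf_div xy mulrBl divff ?gt_eqF // mul1r.
  by apply: le_ln1Dx; rewrite ltrN2 invf_lt1 // /x (ltr_nat _ 1).
have : weight eta M.+1 * (1 + eta * x^-1) <= weight eta M.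
  have -> : weight eta M = weight eta M.+1 * expR (eta * (ln x - ln y)).
    by rewrite /weight -expRD; congr expR; rewrite /x /y; ring.
  rewrite ler_pM2l ?weight_gt0 //; apply: le_trans (expR_ge1Dx _).
  by rewrite lerD2l ler_pM2l.
rewrite -/x; move: (weight _ _) (weight _ _) (x^-1) => a b c; lra.
Qed.

(** Compare X with t^2, t = n+1: X^alpha is at most t^(2 alpha) below t^2,
    and at most X t^(2 alpha - 2) above it. *)
Lemma weight_power (alpha X : R) n : 0 <= alpha -> alpha < 1 -> 0 <= X ->
  X `^ alpha <= weight (2 * (1 - alpha)) n * (X + n.+1%:R ^+ 2).
Proof.
move=> a0 a1 X0; pose t : R := n.+1%:R.
have t0 : 0 < t by rewrite ltr0n.
have t2 : 0 < t ^+ 2 by exact: exprn_gt0.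
have lnt2 : ln (t ^+ 2) = 2 * ln t by rewrite lnXn // mulr_natl.
have w0 := weight_gt0 (2 * (1 - alpha)) n.
rewrite mulrDr; have [h|h] := lerP X (t ^+ 2).
  apply: (@le_trans _ _ ((t ^+ 2) `^ alpha)).
    by rewrite ge0_ler_powR // nnegrE // ltW.
  rewrite -[leLHS]add0r lerD //; first by rewrite mulr_ge0 // ltW.
  rewrite -/t -[X in _ <= _ * X]lnK ?posrE // lnt2 /weight -expRD.
  rewrite /powR gt_eqF // lnt2 ler_expR -/t le_eqVlt.
  by apply/orP; left; apply/eqP; ring.
have Xp : 0 < X by exact: lt_trans h.
rewrite -[leLHS]addr0 lerD //; last by rewrite mulr_ge0 // ltW.
rewrite -[X in _ <= _ * X]lnK ?posrE // /weight -expRD /powR gt_eqF //.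
rewrite ler_expR -/t.
have : ln (t ^+ 2) <= ln X by rewrite ler_ln ?posrE // ltW.
rewrite lnt2 => /(ler_wpM2l (ltac:(lra) : 0 <= 1 - alpha)); lra.
Qed.

End Weights.

(** * Operators with a bounded inverse *)

Section Graphs.
Variables (R : realType) (H : completeNormedModType R[i]).
Variable ip : {dot H for (@Num.conj R[i])}.
Hypothesis ip_norm : forall u : H, `|u| ^+ 2 = ip u u.
Local Notation r := (rip ip).
Local Notation q := (sqn ip).
Let q_ge0 u : 0 <= q u := sqn_ge0 ip_norm u.
Local Hint Resolve q_ge0 : core.

(** All unbounded operators below are inverses of bounded ones; the estimates
    are made on the bounded inverse, an honest function. *)
Definition inv_graph (K : H -> H) : set (H * H) := [set p | p.1 = K p.2].

Lemma op_inv_graph (T : set (H * H)) : op_invertible T ->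
  exists K : {linear H -> H}, exists2 c : R, 0 <= c &
    T = inv_graph K /\ forall x, q (K x) <= c * q x.
Proof.
move=> [c [[_ Tlin Tfun] Tdom Tbnd]].
have ex x : exists u, T (u, x).
  have : dom (op_inv T) x by rewrite Tdom.
  by move=> [u hu]; exists u.
have [k hk] := choice ex.
have [K hK] : exists K : {linear H -> H}, forall u, K u = k u.
  apply: linear_map => a u v.
  exact: Tfun (hk _) (Tlin a u v _ _ (hk u) (hk v)).
exists K, (`|c| ^+ 2); first exact: sqr_ge0.
split=> [|x].
  apply/seteqP; split=> [[u f]|[u f]] /=; rewrite /inv_graph /= => h.
    by rewrite hK; exact: Tfun h (hk f).
  by rewrite h hK.
rewrite -(norm_le_sqn ip_norm) // hK; apply: (le_trans (Tbnd x _ (hk x))).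
by rewrite ler_wpM2r // lecR ler_norm.
Qed.

Lemma inv_graph_comp (L : H -> H) :
  op_comp (inv_graph L) (inv_graph L) = inv_graph (L \o L).
Proof.
rewrite /inv_graph; apply/seteqP; split=> [[u f] [v]|[u f]] /= => [-> ->|h] //.
by exists (L f).
Qed.

Lemma adjoint_inv_graph (K K' : {linear H -> H}) :
  (forall x y, r (K x) y = r x (K' y)) ->
  adjoint ip (inv_graph K) = inv_graph K'.
Proof.
move=> adj; rewrite /inv_graph; apply/seteqP; split=> [[u f]|[u f]] /= h.
  apply: (rip_eq ip_norm) => x; rewrite -adj.
  by rewrite /rip (h (K x) x erefl).
move=> v g /= ->; rewrite h !ipE adj -(lop_jmul K') adj.
by [].
Qed.

Lemma m_accretive_inv_graph (L L' : {linear H -> H}) :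
  (forall x y, r (L x) y = r x (L' y)) ->
  (forall x, 0 <= r (L x) x) -> (forall x, L x = 0 -> x = 0) ->
  m_accretive ip (inv_graph L).
Proof.
move=> adj L_acc L_inj; split.
- split=> [|a u v f g|u f g] /=; rewrite /inv_graph /=.
  + by rewrite (lop0 L).
  + by move=> -> ->; rewrite (lopD L) (lopZ L).
  + move=> -> e; apply/eqP; rewrite -subr_eq0; apply/eqP/L_inj.
    by rewrite (lopD L) (lopN L) e subrr.
- move=> u f; rewrite /inv_graph /= => ->.
  by rewrite -/(rip ip f (L f)) ripC; exact: L_acc.
move=> lam lam0; rewrite /inv_graph.
have bnd x u f : u = L f -> x = f + lam *: u ->
    `|u| <= ((complex.Re lam)^-1)%:C * `|x|.
  move=> -> ->; rewrite (norm_le_sqn ip_norm) ?invr_ge0 ?(ltW lam0) //.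
  rewrite exprVn ler_pdivlMl ?exprn_gt0 //.
  exact: accretive_shift_low.
split.
- split=> [|a u v f g|u f g].
  + by exists 0; rewrite /= ?(lop0 L) ?scaler0 ?addr0 // /inv_graph /= (lop0 L).
  + move=> [f1 /= e1 ->] [g1 /= e2 ->].
    exists (a *: f1 + g1); rewrite /inv_graph /=.
      by rewrite e1 e2 (lopD L) (lopZ L).
    by rewrite !scalerDr !scalerA [lam * a]mulrC addrACA.
  + move=> [f1 /= e1 h1] [g1 /= e2 h2].
    apply/eqP; rewrite -subr_eq0 -normr_le0.
    have := bnd 0 (f - g) (f1 - g1); rewrite normr0 mulr0; apply.
      by rewrite e1 e2 (lopD L) (lopN L).
    by rewrite scalerBr addrACA -opprD -h1 -h2 subrr.
- apply/seteqP; split=> // x _.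
  have [f hf] := resolvent_exists ip_norm adj L_acc lam0 x.
  by exists (L f), f.
- by move=> x u [f /= e1 e2]; exact: bnd e1 e2.
Qed.

(** A root of the inverse of a bounded operator is itself the inverse of a
    bounded operator: with S u = v and S v = f, accretivity on v - u bounds
    v by u and f, since (S + 1) (v - u) = f - u. *)
Lemma sqrt_inv_graph (K : {linear H -> H}) (c : R) (S : set (H * H)) :
  0 <= c -> (forall x, q (K x) <= c * q x) ->
  m_accretive ip S -> op_comp S S = inv_graph K ->
  exists L : {linear H -> H}, exists2 l : R, 0 <= l &
    [/\ S = inv_graph L, forall x, q (L x) <= l * q x,
        forall x, 0 <= r (L x) x, forall x, L x = 0 -> x = 0
      & forall x, L (L x) = K x].
Proof.
move=> c0 K_bnd [[S0 Slin Sfun] Sacc _] SS.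
have ex f : exists v, S (v, f) /\ S (K f, v).
  have [v h1 h2] : op_comp S S (K f, f) by rewrite SS.
  by exists v.
have [k hk] := choice ex.
have SB u v f g : S (u, f) -> S (v, g) -> S (u - v, f - g).
  move=> h1 h2; have := Slin (-1) _ _ _ _ h2 h1.
  by rewrite !scaleN1r ![- _ + _]addrC.
have Sinj u f v : S (u, f) -> S (v, f) -> u = v.
  move=> h1 h2; have h := SB _ _ _ _ h1 h2; rewrite subrr in h.
  have : op_comp S S (u - v, 0) by exists 0.
  by rewrite SS /inv_graph /= (lop0 K) => /eqP; rewrite subr_eq0 => /eqP.
have [L hL] : exists L : {linear H -> H}, forall u, L u = k u.
  apply: linear_map => a u v.
  exact: Sinj (hk _).1 (Slin a _ _ _ _ (hk u).1 (hk v).1).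
exists L, (6 * c + 4); first by lra.
split.
- apply/seteqP; split=> [[u f]|[u f]] /=; rewrite /inv_graph /= => h.
    by rewrite hL; exact: Sinj h (hk f).1.
  by rewrite h hL; exact: (hk f).1.
- move=> f; have [h1 h2] := hk f; rewrite hL; set v := k f in h1 h2 *.
  set u := K f in h2.
  have h3 := Sacc _ _ (SB _ _ _ _ h1 h2); rewrite -/(rip ip _ _) in h3.
  have h4 : q (v - u) <= q (f - u).
    have -> : f - u = (f - v) + (v - u) by rewrite addrA subrK.
    by rewrite [leRHS]sqnD; have := q_ge0 (f - v); lra.
  have h5 := sqnD_le ip_norm f (- u); rewrite (sqnN ip) in h5.
  have h6 := sqnD_le ip_norm (v - u) u; rewrite subrK in h6.
  by have := K_bnd f; rewrite -/u; lra.
- by move=> f; rewrite hL ripC; exact: Sacc _ _ (hk f).1.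
- move=> f; rewrite hL => e; have := (hk f).1; rewrite e => h.
  exact: Sfun h S0.
- move=> f; rewrite hL; apply: (Sinj _ (k f)).
    by rewrite hL; exact: (hk _).1.
  exact: (hk f).2.
Qed.

End Graphs.

(** * Square roots, forms and the form sum *)

Section FormSums.
Variables (R : realType) (H : completeNormedModType R[i]).
Variable ip : {dot H for (@Num.conj R[i])}.
Hypothesis ip_norm : forall u : H, `|u| ^+ 2 = ip u u.
Local Notation r := (rip ip).
Local Notation q := (sqn ip).
Let q_ge0 u : 0 <= q u := sqn_ge0 ip_norm u.
Local Hint Resolve q_ge0 : core.

Definition has_sqrt (T : set (H * H)) : Prop :=
  exists S, m_accretive ip S /\ op_comp S S = T.

(** Uniqueness of the accretive root identifies the root chosen by
    [op_sqrt]. *)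
Lemma op_sqrt_inv_graph (L L' : {linear H -> H}) (l : R) :
  (forall x y, r (L x) y = r x (L' y)) ->
  (forall x, 0 <= r (L x) x) -> (forall x, 0 <= r (L (L x)) x) ->
  (forall x, L x = 0 -> x = 0) ->
  0 <= l -> (forall x, q (L x) <= l * q x) ->
  op_sqrt ip (inv_graph (L \o L)) = inv_graph L.
Proof.
move=> adj L_acc L2_acc L_inj l0 L_bnd.
have c0 : 0 <= l * l by rewrite mulr_ge0.
pose K : {linear H -> H} := (L \o L)%FUN.
have K_bnd x : q (K x) <= l * l * q x.
  by apply: (le_trans (L_bnd _)); rewrite -mulrA ler_wpM2l.
have [A [AL LA]] := resolvent_one ip_norm adj L_acc.
have uniq S : m_accretive ip S -> op_comp S S = inv_graph (L \o L) ->
    S = inv_graph L.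
  move=> Sacc SS.
  have [M [m m0 [-> M_bnd M_acc M_inj M2]]] :=
    sqrt_inv_graph ip_norm (K := K) c0 K_bnd Sacc SS.
  have ML := accretive_sqrt_unique ip_norm L_acc L2_acc AL LA l0 L_bnd
    m0 M_acc M_bnd M_inj M2.
  by rewrite /inv_graph; apply/seteqP; split=> -[u f] /=; rewrite ML.
apply: xget_subset1.
  split; last exact: inv_graph_comp.
  exact: m_accretive_inv_graph adj L_acc L_inj.
by move=> S1 S2 [h1 e1] [h2 e2]; rewrite (uniq _ h1 e1) (uniq _ h2 e2).
Qed.

(** Here L^-1 is the m-accretive root of T, and L'^-1 that of T*. *)
Record sqrt_data (T : set (H * H)) (L L' : {linear H -> H}) (l : R) : Prop := {
  sd_adj : forall x y, r (L x) y = r x (L' y);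
  sd_acc : forall x, 0 <= r (L x) x;
  sd_acc2 : forall x, 0 <= r (L (L x)) x;
  sd_inj : forall x, L x = 0 -> x = 0;
  sd_ge0 : 0 <= l;
  sd_bnd : forall x, q (L x) <= l * q x;
  sd_bnd' : forall x, q (L' x) <= l * q x;
  sd_graph : T = inv_graph (L \o L);
  sd_sqrt : op_sqrt ip T = inv_graph L;
  sd_sqrt' : op_sqrt ip (adjoint ip T) = inv_graph L' }.

Lemma sqrt_dataP T : m_accretive ip T -> op_invertible T -> has_sqrt T ->
  exists L L' l, sqrt_data T L L' l.
Proof.
move=> [_ Tacc _] /(op_inv_graph ip_norm)[K [c c0 [TK K_bnd]]] [S [Sacc SS]].
rewrite TK in SS.
have [L [l l0 [SL L_bnd L_acc L_inj L2]]] :=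
  sqrt_inv_graph ip_norm c0 K_bnd Sacc SS.
have [L' [adj L'_bnd]] := adjoint_exists ip_norm l0 L_bnd.
have TL : T = inv_graph (L \o L).
  by rewrite TK /inv_graph; apply/seteqP; split=> -[u f] /=; rewrite L2.
have acc2 x : 0 <= r (L (L x)) x by rewrite ripC; apply: Tacc; rewrite TL.
have adj2 x y : r (L (L x)) y = r x (L' (L' y)) by rewrite !adj.
have adT : adjoint ip T = inv_graph (L' \o L').
  by rewrite TL; exact: (adjoint_inv_graph ip_norm
    (K := (L \o L)%FUN) (K' := (L' \o L')%FUN)).
exists L, L', l; split=> //.
- by rewrite TL; exact: op_sqrt_inv_graph adj L_acc acc2 L_inj l0 L_bnd.
- rewrite adT; apply: (op_sqrt_inv_graph (L' := L) _ _ _ _ l0 L'_bnd).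
  + exact: adj_sym.
  + exact: adj_acc.
  + by move=> x; rewrite ripC -adj2.
  + exact: adj_inj adj L_acc L_inj.
Qed.

(** The adjoint of a root of T* is a root of T** = T. This covers the default
    value of [op_sqrt]: it is taken for both T and T* or for neither. *)
Lemma has_sqrt_adjoint T : op_invertible T ->
  has_sqrt (adjoint ip T) -> has_sqrt T.
Proof.
move=> /(op_inv_graph ip_norm)[K [c c0 [TK K_bnd]]] [S [Sacc SS]].
have [K' [adjK K'_bnd]] := adjoint_exists ip_norm c0 K_bnd.
rewrite TK (adjoint_inv_graph ip_norm adjK) in SS.
have [M [m m0 [SM M_bnd M_acc M_inj M2]]] :=
  sqrt_inv_graph ip_norm c0 K'_bnd Sacc SS.
have [M' [adj M'_bnd]] := adjoint_exists ip_norm m0 M_bnd.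
exists (inv_graph M'); split.
  apply: (m_accretive_inv_graph (L' := M) ip_norm).
  - exact: adj_sym.
  - exact: adj_acc.
  - exact: adj_inj adj M_acc M_inj.
rewrite inv_graph_comp TK /inv_graph.
have e x : M' (M' x) = K x.
  apply: (rip_eq ip_norm) => y.
  by rewrite -!adj M2 (ripC _ y) adjK ripC.
by apply/seteqP; split=> -[u f] /=; rewrite e.
Qed.

Lemma dom_inv_graph (L : H -> H) : dom (inv_graph L) = range L.
Proof.
by apply/seteqP; split=> u [f h]; exists f.
Qed.

Lemma appl_inv_graph (L : {linear H -> H}) f :
  (forall x, L x = 0 -> x = 0) -> appl (inv_graph L) (L f) = f.
Proof.
move=> L_inj; apply: xget_subset1 => // g h /= e1 e2.
apply/eqP; rewrite -subr_eq0; apply/eqP/L_inj.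
by rewrite (lopD L) (lopN L) -e1 -e2 subrr.
Qed.

(** The same condition as [imag_bound], for the unbounded operator. *)
Definition range_bound (b : nat -> R) (T : set (H * H)) : Prop :=
  forall u f, T (u, f) -> forall n,
    `|r f (jmul u)| <= b n * (r f u + n.+1%:R ^+ 2 * q u).

Lemma num_range_bound (T : set (H * H)) (alpha beta : R) :
  is_operator T -> 0 <= alpha -> alpha < 1 -> 0 < beta ->
  num_range ip T `<=` region alpha beta ->
  range_bound (fun n => beta * weight (2 * (1 - alpha)) n) T.
Proof.
move=> [T0 Tlin _] a0 a1 b0 Trange u f Tuf n.
have := q_ge0 u; rewrite le_eqVlt => /predU1P[e|q0].
  rewrite -e (sqn_eq0 ip_norm (esym e)) /jmul scaler0 !rip0r normr0.
  by rewrite mulr0 addr0 mulr0.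
pose c := (Num.sqrt (q u))^-1.
have sE : Num.sqrt (q u) ^+ 2 = q u by rewrite sqr_sqrtr // ltW.
have cE : c ^+ 2 * q u = 1 by rewrite exprVn sE mulVf // gt_eqF.
have Tc : T (c%:C *: u, c%:C *: f).
  by have := Tlin c%:C _ _ _ _ Tuf T0; rewrite !addr0.
have nc : `|c%:C *: u| = 1.
  have : `|c%:C *: u| ^+ 2 = 1 by rewrite (sqn_norm ip_norm) sqnZ cE.
  by move/eqP; rewrite sqrp_eq1 // => /eqP.
have := Trange _ (ex_intro _ _ (ex_intro _ _ (And3 Tc nc erefl))).
rewrite /region /= -/(rip ip _ _) -rip_jr.
have -> : jmul (c%:C *: u) = c%:C *: jmul u by rewrite /jmul !scalerA mulrC.
rewrite !ripE ![c * (c * _)]mulrA -!expr2 => -[X0 hY].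
have w := weight_power n a0 a1 X0.
have {}hY := le_trans hY (ler_wpM2l (ltW b0) w).
rewrite normrM ger0_norm ?sqr_ge0 // in hY.
have {}hY := ler_wpM2r (ltW q0) hY.
have cancel x : c ^+ 2 * x * q u = x.
  by rewrite -[RHS]mul1r -cE; move: (c ^+ 2) => d; ring.
rewrite cancel in hY; apply: (le_trans hY).
set w0 := weight _ n; set t2 := n.+1%:R ^+ 2.
have -> : beta * (w0 * (c ^+ 2 * r f u + t2)) * q u
  = beta * w0 * (c ^+ 2 * r f u * q u + t2 * q u).
  by move: (c ^+ 2) => d; ring.
by rewrite cancel.
Qed.

Section Comparison.
Variables (T : set (H * H)) (L L' : {linear H -> H}) (l : R).
Hypothesis T_sqrt : sqrt_data T L L' l.
Variables (b : nat -> R) (s : R).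
Hypothesis b_ge0 : forall n, 0 <= b n.
Hypothesis b_le : forall n, b n <= b 0%N.
Hypothesis b_sum : forall N, \sum_(n < N) b n / n.+1%:R <= s.
Hypothesis T_im : range_bound b T.

Let L2_im : imag_bound ip b (L \o L).
Proof.
move=> k x /=; rewrite rip_jC normrN [r _ x]ripC.
by apply: T_im; rewrite (sd_graph T_sqrt).
Qed.

(** The numerical range condition passes from an operator to its form. The
    form has its values on the form domain only because the roots of T and
    of T* have the same domain. *)
Lemma form_range_bound :
  forall u, form_dom (form_of ip T) u -> forall n,
    let z := form_val (form_of ip T) u u in
    `|complex.Im z| <= b n * (complex.Re z + n.+1%:R ^+ 2 * q u).
Proof.
case: (T_sqrt) => adj acc acc2 inj l0 bnd bnd' TL sq sq' u /= hu n.
rewrite sq dom_inv_graph in hu; case: hu => f _ <-.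
have [g hg] :=
  range_sub_adjoint ip_norm adj acc acc2 l0 bnd b_ge0 b_le b_sum L2_im f.
rewrite sq sq' appl_inv_graph // -{1 2}hg appl_inv_graph; last first.
  exact: adj_inj adj acc inj.
rewrite -rip_jr -/(rip ip f g).
have h := form_imag_bound ip_norm adj acc2 b_ge0 inj L2_im (esym hg).
exact: h.
Qed.

Lemma dom_sqrt_adjoint :
  dom (op_sqrt ip T) = dom (op_sqrt ip (adjoint ip T)).
Proof.
case: (T_sqrt) => adj acc acc2 inj l0 bnd bnd' TL sq sq'.
have adj2 x y : r (L (L x)) y = r x (L' (L' y)) by rewrite !adj.
have L'2_im : imag_bound ip b (L' \o L').
  exact: (imag_bound_adjoint ip_norm (K := (L \o L)%FUN) (K' := (L' \o L')%FUN)
    adj2 acc2 b_ge0 L2_im).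
have acc2' x : 0 <= r (L' (L' x)) x by rewrite ripC -adj2.
rewrite sq sq' !dom_inv_graph; apply/seteqP; split=> _ [f _ <-].
  have [w <-] :=
    range_sub_adjoint ip_norm adj acc acc2 l0 bnd b_ge0 b_le b_sum L2_im f.
  by exists w.
have [w <-] := range_sub_adjoint ip_norm (adj_sym adj) (adj_acc adj acc) acc2'
  l0 bnd' b_ge0 b_le b_sum L'2_im f.
by exists w.
Qed.

End Comparison.

End FormSums.

Theorem theorem3p6 (R : realType) (H : completeNormedModType R[i])
    (ip : {dot H for (@Num.conj R[i])})
    (ip_norm : forall u : H, `|u| ^+ 2 = ip u u)
    (alpha beta beta' : R)
    (alpha_ge0 : 0 <= alpha) (alpha_lt1 : alpha < 1)
    (beta_gt0 : 0 < beta) (beta'_gt0 : 0 < beta')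
    (A B : set (H * H))
    (A_macc : m_accretive ip A) (A_inv : op_invertible A)
    (B_macc : m_accretive ip B) (B_inv : op_invertible B)
    (A_range : num_range ip A `<=` region alpha beta)
    (B_range : num_range ip B `<=` region alpha beta')
    (dense_dom : dense (dom (op_sqrt ip A) `&` dom (op_sqrt ip B)))
    (sum_inv : op_invertible (form_sum ip A B))
    (sum_macc : m_accretive ip (form_sum ip A B)) :
  dom (op_sqrt ip (form_sum ip A B)) =
  dom (op_sqrt ip (adjoint ip (form_sum ip A B))).
Proof.
pose w := weight (2 * (1 - alpha)).
have eta0 : 0 < 2 * (1 - alpha) by move: alpha_lt1; lra.
have w0 n : 0 < w n := weight_gt0 _ n.
have wle n : w n <= w 0%N by exact: weight_le (ltW eta0).
have [s ws] : exists s : R, forall N, \sum_(n < N) w n / n.+1%:R <= s.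
  by exists (1 + (2 * (1 - alpha))^-1) => N; exact: weight_sum.
have w_ge0 (c : R) : 0 < c -> forall n, 0 <= c * w n.
  by move=> c0 n; rewrite mulr_ge0 // ltW.
have w_le (c : R) : 0 < c -> forall n, c * w n <= c * w 0%N.
  by move=> c0 n; rewrite ler_wpM2l // ltW.
have w_sum (c : R) : 0 < c -> forall N, \sum_(n < N) c * w n / n.+1%:R <= c * s.
  move=> c0 N; under eq_bigr do rewrite -mulrA.
  by rewrite -mulr_sumr ler_wpM2l // ltW.
have sqrt_ne T : dom (op_sqrt ip T) !=set0 -> has_sqrt ip T.
  case: (pselect (has_sqrt ip T)) => // no [u [f]].
  by rewrite /op_sqrt xgetPN // => S hS; apply: no; exists S.
(* A dense set is not empty, so A and B have roots. *)
have [u [uA uB]] : (dom (op_sqrt ip A) `&` dom (op_sqrt ip B)) !=set0.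
  have [|v [_ hv]] := dense_dom setT _ openT; first by exists 0.
  by exists v.
have [LA [LA' [lA dA]]] : exists L L' l, sqrt_data ip A L L' l.
  by apply: sqrt_dataP => //; apply: sqrt_ne; exists u.
have [LB [LB' [lB dB]]] : exists L L' l, sqrt_data ip B L L' l.
  by apply: sqrt_dataP => //; apply: sqrt_ne; exists u.
set C := form_sum ip A B.
(* The factor 2 makes up for adding (n+1)^2 |v|^2 twice. *)
have sum_im : range_bound ip (fun n => 2 * (beta + beta') * w n) C.
  move=> v f Cvf n; have [[/= vA vB] /(_ v (conj vA vB)) /= e] := Cvf.
  have A_op : is_operator A by case: A_macc.
  have B_op : is_operator B by case: B_macc.
  have A_im :=
    num_range_bound ip_norm A_op alpha_ge0 alpha_lt1 beta_gt0 A_range.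
  have B_im :=
    num_range_bound ip_norm B_op alpha_ge0 alpha_lt1 beta'_gt0 B_range.
  have hA := form_range_bound ip_norm dA (w_ge0 _ beta_gt0) (w_le _ beta_gt0)
    (w_sum _ beta_gt0) A_im vA n.
  have hB := form_range_bound ip_norm dB (w_ge0 _ beta'_gt0) (w_le _ beta'_gt0)
    (w_sum _ beta'_gt0) B_im vB n.
  have fv : 0 <= rip ip f v by case: sum_macc => _ h _; exact: h.
  move: hA hB e; rewrite /form_of /=; move: (ip _ _) (ip _ _) => zB zA hA hB e.
  have eR : rip ip f v = complex.Re zA + complex.Re zB.
    by rewrite /rip -e complex_ReD.
  have eI : rip ip f (jmul v) = complex.Im zA + complex.Im zB.
    by rewrite rip_jr -e complex_ImD.
  rewrite eR in fv *; rewrite eI.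
  have q0 : 0 <= n.+1%:R ^+ 2 * sqn ip v.
    by rewrite mulr_ge0 ?sqr_ge0 // sqn_ge0.
  have pos (c z X : R) : 0 < c -> `|z| <= c * w n * X -> 0 <= X.
    move=> c0 /(le_trans (normr_ge0 z)); rewrite pmulr_rge0 // mulr_gt0 //.
  have pA := pos _ _ _ beta_gt0 hA; have pB := pos _ _ _ beta'_gt0 hB.
  apply: (le_trans (ler_normD _ _)); apply: (le_trans (lerD hA hB)).
  move: (n.+1%:R ^+ 2 * _) q0 pA pB => t q0 pA pB.
  have h1 := mulr_ge0 (w_ge0 _ beta_gt0 n) pB.
  have h2 := mulr_ge0 (w_ge0 _ beta'_gt0 n) pA.
  have h3 := mulr_ge0 (w_ge0 _ beta_gt0 n) fv.
  have h4 := mulr_ge0 (w_ge0 _ beta'_gt0 n) fv.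
  by move: h1 h2 h3 h4; lra.
have C_eq : has_sqrt ip C ->
    dom (op_sqrt ip C) = dom (op_sqrt ip (adjoint ip C)).
  move=> /(sqrt_dataP ip_norm sum_macc sum_inv)[L [L' [l d]]].
  have bb : 0 < 2 * (beta + beta') by move: beta_gt0 beta'_gt0; lra.
  exact: (dom_sqrt_adjoint ip_norm d (w_ge0 _ bb) (w_le _ bb)
    (w_sum _ bb) sum_im).
have [/C_eq //|noC] := pselect (has_sqrt ip C).
have noC' : ~ has_sqrt ip (adjoint ip C).
  by move=> /(has_sqrt_adjoint ip_norm sum_inv).
rewrite /op_sqrt !xgetPN // => S hS; [apply: noC'|apply: noC]; by exists S.
Qed.
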